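(* Let $m\in\{1,2,3\}$, let $B_1\subset\mathbb{R}^n$ be the unit Euclidean ball and $g$ a smooth metric tensor on $B_1$. Let $J$ be a smooth square-matrix-valued function on $B_1$ with $J^2=-id$. Then for every fixed constant matrix $\lambda_0$, the expression $T_m=JQ_m+Q_mJ$, where $Q_m=\Delta^m(J^2)-\Delta^mJ\,J-J\,\Delta^mJ$, can be rewritten in the form $$T_m=T_{\lambda_0}-\big[J-\lambda_0,[\Delta^mJ,J]\big],$$ where $T_{\lambda_0}$ is a linear combination of terms of the form $$\nabla^\alpha\Big((J-\lambda_0)\ast\nabla^\beta J\ast\nabla^\gamma J\Big)\quad\text{or}\quad\lambda_0\ast\nabla^\alpha\Big((J-\lambda_0)\ast\nabla^\delta J\Big),$$ with multi-indices $\alpha,\beta,\gamma,\delta$ such that $1\le|\alpha|\le2m-1$, $0\le|\beta|,|\gamma|,|\delta|\le m$, $|\alpha|+|\beta|+|\gamma|=2m$ and $|\alpha|+|\delta|=2m$.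
   Context: $J$ is regarded as a matrix of scalar functions (not as a $(1,1)$ tensor field), so $\nabla\lambda_0=0$ for every constant matrix $\lambda_0$; $\nabla$ and $\Delta$ are the covariant derivative and Laplace-Beltrami operator of $g$ acting entrywise. $[A,B]=AB-BA$. $A\ast B$ denotes a composition (matrix product) of the terms in some order, such as $AB$ or $BA$; the derivative indices in $\nabla^\alpha,\nabla^\beta,\nabla^\gamma,\nabla^\delta$ are contracted in pairs with $g$ so that each term is matrix-valued. *)

(* Defs.v *)
From mathcomp Require Import all_boot all_order all_algebra all_fingroup.
From mathcomp Require Import all_classical all_reals all_analysis.

Set Implicit Arguments.
Unset Strict Implicit.
Unset Printing Implicit Defensive.

Import Order.TTheory GRing.Theory Num.Theory.
Import numFieldNormedType.Exports.
Local Open Scope classical_set_scope.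
Local Open Scope ring_scope.

(* The normed space structure of 'rV[R]_n is that of the sup norm, hence the
   explicit sum of squares. *)
Definition unit_ball {R : realType} {n : nat} : set 'rV[R]_n :=
  [set x | \sum_(i < n) x 0 i ^+ 2 < 1].

Section Geometry.
Context {R : realType} {n : nat}.
Implicit Types (f : 'rV[R]_n -> R) (g : 'rV[R]_n -> 'M[R]_n).

Definition partial (i : 'I_n) f : 'rV[R]_n -> R := fun x => 'D_('e_i) f x.

(* C^infinity on an open set U: every iterated partial derivative exists and is
   continuous at every point of U. *)
Definition smooth_on (U : set 'rV[R]_n) f : Prop :=
  forall (s : seq 'I_n) (x : 'rV[R]_n), U x ->
    {for x, continuous (foldr partial f s)} /\
    forall i : 'I_n, derivable (foldr partial f s) x 'e_i.

Definition smooth_mx_on (U : set 'rV[R]_n) (p q : nat)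
    (F : 'rV[R]_n -> 'M[R]_(p, q)) : Prop :=
  forall i j, smooth_on U (fun x => F x i j).

Definition metric_on (U : set 'rV[R]_n) g : Prop :=
  smooth_mx_on U g /\
  forall x, U x ->
    (g x)^T = g x /\
    forall v : 'rV[R]_n, v != 0 -> 0 < (v *m g x *m v^T) 0 0.

(* Gamma^l_ij; the inverse metric g^{ij} is invmx (g x) i j. *)
Definition christoffel g (l i j : 'I_n) : 'rV[R]_n -> R := fun x =>
  2^-1 * \sum_(k < n) invmx (g x) l k *
    (partial i (fun y => g y j k) x + partial j (fun y => g y i k) x
     - partial k (fun y => g y i j) x).

(* A covariant tensor field of rank k is given by its components
   T [:: i1; ...; ik]; its values on lists of any other length are irrelevant. *)
Definition tensor (V : Type) := seq 'I_n -> 'rV[R]_n -> V.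

(* (nabla T)_(i, i1, ..., ik) = nabla_i T_(i1, ..., ik): the differentiation
   index comes first. *)
Definition cov g (T : tensor R) : tensor R := fun I x =>
  if I is i :: I' then
    partial i (T I') x
    - \sum_(s < size I') \sum_(l < n)
        christoffel g l i (nth i I' s) x * T (set_nth i I' s l) x
  else 0.

(* Laplace-Beltrami operator as the metric trace of the Hessian nabla^2 f. *)
Definition laplace g f : 'rV[R]_n -> R := fun x =>
  \sum_(i < n) \sum_(j < n)
    invmx (g x) i j * iter 2 (cov g) (fun _ => f) [:: i; j] x.

Section MatrixValued.
Context {N : nat}.
Implicit Types (F : 'rV[R]_n -> 'M[R]_N).

Definition cov_mx g (T : tensor 'M[R]_N) : tensor 'M[R]_N := fun I x =>
  \matrix_(p, q) cov g (fun I' y => T I' y p q) I x.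

Definition laplace_mx g F : 'rV[R]_n -> 'M[R]_N := fun x =>
  \matrix_(p, q) laplace g (fun y => F y p q) x.

Definition nabla g (a : nat) (T : tensor 'M[R]_N) : tensor 'M[R]_N :=
  iter a (cov_mx g) T.

Definition nabla_fun g (a : nat) F : tensor 'M[R]_N := nabla g a (fun _ => F).

(* Full contraction with g of a tensor of rank k, the r-th index being paired
   with the (sigma r)-th one; sigma is meant to satisfy is_pairing below. *)
Definition contract g (k : nat) (sigma : 'S_k) (T : tensor 'M[R]_N) :
    'rV[R]_n -> 'M[R]_N := fun x =>
  \sum_(I : k.-tuple 'I_n)
    (\prod_(r < k | (r < sigma r)%N)
       invmx (g x) (tnth I r) (tnth I (sigma r))) *: T I x.

End MatrixValued.
End Geometry.

Definition is_pairing (k : nat) (sigma : 'S_k) : Prop :=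
  forall r, sigma (sigma r) = r /\ sigma r != r.

Section Expressions.
Context {R : realType} {N : nat}.

Definition bracket (A B : 'M[R]_N) : 'M[R]_N := A * B - B * A.

(* The product of k matrices in the order prescribed by s. *)
Definition star (k : nat) (s : 'S_k) (A : k.-tuple 'M[R]_N) : 'M[R]_N :=
  \prod_(i < k) tnth A (s i).

Context {n : nat}.
Implicit Types (g : 'rV[R]_n -> 'M[R]_n) (J : 'rV[R]_n -> 'M[R]_N).

Definition laplace_pow g (m : nat) J : 'rV[R]_n -> 'M[R]_N :=
  iter m (laplace_mx g) J.

Definition Q_ g (m : nat) J : 'rV[R]_n -> 'M[R]_N := fun x =>
  laplace_pow g m (fun y => J y ^+ 2) x
  - laplace_pow g m J x * J x - J x * laplace_pow g m J x.

Definition T_ g (m : nat) J : 'rV[R]_n -> 'M[R]_N := fun x =>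
  J x * Q_ g m J x + Q_ g m J x * J x.

End Expressions.

(* Formal expressions: [Cubic a b c s sigma] stands for
     nabla^a ((J - lambda0) * nabla^b J * nabla^c J)
   and [Quadratic a d s s' sigma] for
     lambda0 * nabla^a ((J - lambda0) * nabla^d J),
   where s, s' record the orders of the products and sigma the contraction. *)
Inductive term : Type :=
| Cubic (a b c : nat) (s : 'S_3) (sigma : 'S_(a + b + c))
| Quadratic (a d : nat) (s s' : 'S_2) (sigma : 'S_(a + d)).

Definition admissible (m : nat) (t : term) : Prop :=
  match t with
  | Cubic a b c _ sigma =>
      [/\ (1 <= a <= 2 * m - 1)%N, (b <= m)%N, (c <= m)%N,
          (a + b + c = 2 * m)%N & is_pairing sigma]
  | Quadratic a d _ _ sigma =>
      [/\ (1 <= a <= 2 * m - 1)%N, (d <= m)%N,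
          (a + d = 2 * m)%N & is_pairing sigma]
  end.

Definition eval_term {R : realType} {n N : nat} (g : 'rV[R]_n -> 'M[R]_n)
    (J : 'rV[R]_n -> 'M[R]_N) (lambda0 : 'M[R]_N) (t : term) :
    'rV[R]_n -> 'M[R]_N :=
  match t with
  | Cubic a b c s sigma =>
      contract g sigma (nabla g a (fun I x =>
        star s [tuple J x - lambda0; nabla_fun g b J (take b I) x;
                      nabla_fun g c J (drop b I) x]))
  | Quadratic a d s s' sigma => fun x =>
      star s [tuple lambda0;
        contract g sigma (nabla g a (fun I y =>
          star s' [tuple J y - lambda0; nabla_fun g d J I y])) x]
  end.

(* Main.v *)
Require Import Defs.
From mathcomp Require Import all_boot all_order all_algebra all_fingroup.
From mathcomp Require Import all_classical all_reals all_analysis.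
From mathcomp Require Import ring zify.
Import Order.TTheory GRing.Theory Num.Theory.
Import numFieldNormedType.Exports.
Local Open Scope ring_scope.

Set Implicit Arguments.
Unset Strict Implicit.
Unset Printing Implicit Defensive.

(** Write P = J - lambda0 and L = Delta^m J. Since J^2 = -1 is constant,
    Delta^m (J^2) = 0 and T_m = 2 L - 2 J L J, while [J, [L, J]] = 2 L + 2 J L J.
    Hence

      T_m + [P, [L, J]] = 4 L - [lambda0, [L, J]],

    and it is the right-hand side that is written with admissible terms. Cubic
    terms alone suffice.

    The metric is parallel, so L is the contraction of nabla^(2m) J along the
    pairing (1 2)(3 4)... ([laplace_pow_contract]). A tensor of rank 2m is called
    [expressible] when each of its full contractions is a linear combination of
    admissible terms, with coefficients that do not depend on n, N, g, J, lambda0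
    or the point. Because all pairings are allowed, this property is insensitive
    to the order of the indices ([expressible_rearr]); so no commutation of
    covariant derivatives occurs and only the numbers of derivatives matter in the
    Leibniz rule.

    - Let A, B, C be derivatives of J of positive orders and a > 0. Then
      nabla^a (A B C) is expressible ([expressible_cubic]): integrate by parts
      until one factor is P. For m <= 3 the three orders add up to at most 5, and
      this leaves enough room to keep the orders of the other two factors at most
      m; this is where the bound on m enters.
    - Put A_b = J nabla^b J + nabla^b J J. Then A_1 = nabla (J^2) = 0, and
      nabla A_b is A_(b+1) plus products of two derivatives of J. By induction on
      b, nabla^a (A_b nabla^c J) and nabla^a (nabla^c J A_b) are expressible for
      a, b, c > 0 ([expressible_anticomm_mul], [expressible_mul_anticomm]).
    - Hence so is nabla^a [J, nabla^b J nabla^c J], because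
      [J, U V] = (J U + U J) V - U (J V + V J). When b and c are at most m,
      nabla^a [P, nabla^b J nabla^c J] is a difference of two admissible shapes;
      as lambda0 = J - P, this makes [lambda0, nabla^a (nabla^b J nabla^c J)]
      expressible. Integration by parts extends this to all a, b, c > 0
      ([expressible_lam_quadratic]).
    - The Leibniz rule for [nabla^b J, J] produces only such quadratic terms.
      Modulo expressible tensors, [lambda0, nabla^a [nabla^b J, J]] with a, b > 0
      and a + b = 2m therefore does not depend on b, and for b = 1 it is
      nabla^(2m-1) [J, [nabla J, J]] = 4 nabla^(2m) J ([expressible_comm]). These
      are the four copies of L.
    - The last step, from a = 1 to a = 0, leaves the commutator of nabla^(2m-1) J
      with nabla J, with no outer derivative. Moving derivatives one at a time to
      the second factor turns it, up to sign and expressible tensors, into the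
      commutator of two copies of nabla^m J that carry the first m indices in
      reverse order and the last m indices. The pairing (1 2)(3 4)... is invariant
      under reversal, which exchanges the two factors; so this contraction
      vanishes ([folded_mid]). *)

(** * Smooth functions on an open set *)

Section SmoothFunctions.
Context {R : realType} {n : nat}.
Variable U : set 'rV[R]_n.
Hypothesis openU : open U.
Implicit Types (f h : 'rV[R]_n -> R).

Lemma near_in x f h : U x -> (forall y, U y -> f y = h y) ->
  {near x, f =1 h}.
Proof. by move=> Ux fh; apply: filterS (open_nbhs_nbhs (conj openU Ux)). Qed.

Lemma eq_partial i f h x : U x -> (forall y, U y -> f y = h y) ->
  partial i f x = partial i h x.
Proof. by move=> Ux fh; exact/near_eq_derive/near_in. Qed.

(** Smoothness up to a finite order, by recursion on the order: the closure
    properties below follow by induction, since the derivative of a product or of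
    an inverse is built from functions that are smooth to one order less. *)
Fixpoint smooth_upto (k : nat) f : Prop :=
  (forall x, U x ->
     {for x, continuous f} /\ forall i : 'I_n, derivable f x 'e_i) /\
  if k is k'.+1 then forall i, smooth_upto k' (partial i f) else True.

Lemma smooth_upto_deriv k f x : smooth_upto k f -> U x ->
  {for x, continuous f} /\ forall i : 'I_n, derivable f x 'e_i.
Proof. by case: k => [|k] [fU _]; exact: fU. Qed.

Lemma smooth_uptoW k f : smooth_upto k.+1 f -> smooth_upto k f.
Proof. by elim: k f => [|k IH] f [fU df]; split=> // i; exact/IH/df. Qed.

Lemma smooth_onP f : smooth_on U f <-> forall k, smooth_upto k f.
Proof.
split=> [fS k|fS].
  elim: k f fS => [|k IH] f fS; split=> //; try exact: (fS [::]).
  by move=> i; apply: IH => s; move: (fS (rcons s i)); rewrite foldr_rcons.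
move=> s; elim/last_ind: s f fS => [|s i IH] f fS x Ux.
  exact: smooth_upto_deriv (fS 0%N) Ux.
by rewrite foldr_rcons; apply: IH => // k; have [_ df] := fS k.+1; exact: df.
Qed.

Lemma eq_smooth_upto k f h : (forall y, U y -> f y = h y) ->
  smooth_upto k f -> smooth_upto k h.
Proof.
elim: k f h => [|k IH] f h fh [fU df]; split; try exact: I.
1,2: move=> x Ux; have [cf dff] := fU x Ux; have fhx := near_in Ux fh.
1,2: split=> [|i]; last exact: near_eq_derivable (dff i).
1,2: by rewrite /prop_for /continuous_at -fh//;
  exact: cvg_trans (near_eq_cvg fhx) cf.
by move=> i; apply: IH (df i) => y Uy; exact: eq_partial.
Qed.

Lemma eq_smooth_on f h : (forall y, U y -> f y = h y) ->
  smooth_on U f -> smooth_on U h.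
Proof.
move=> fh /smooth_onP fS; apply/smooth_onP => k.
exact: eq_smooth_upto (fS k).
Qed.

Lemma smooth_derivable f x i : smooth_on U f -> U x -> derivable f x 'e_i.
Proof. by move=> fS Ux; have [_ d] := fS [::] x Ux; exact: d. Qed.

Lemma smooth_partial f i : smooth_on U f -> smooth_on U (partial i f).
Proof.
by move=> /smooth_onP fS; apply/smooth_onP => k; have [_ df] := fS k.+1; exact: df.
Qed.

Lemma partial_cst i (c : R) (x : 'rV[R]_n) : partial i (fun=> c) x = 0.
Proof. exact: derive_cst. Qed.

Lemma smooth_cst (c : R) : smooth_on U (fun=> c).
Proof.
apply/smooth_onP => k; elim: k c => [|k IH] c; split=> //.
1,2: by move=> x _; split=> [|i]; [exact: cst_continuous|exact: derivable_cst].
move=> i; apply: eq_smooth_upto (IH 0) => y _.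
by rewrite partial_cst.
Qed.

Lemma partialD i f h x : smooth_on U f -> smooth_on U h -> U x ->
  partial i (fun y => f y + h y) x = partial i f x + partial i h x.
Proof. by move=> fS hS Ux; apply: deriveD; exact: smooth_derivable. Qed.

Lemma partialM i f h x : smooth_on U f -> smooth_on U h -> U x ->
  partial i (fun y => f y * h y) x = partial i f x * h x + f x * partial i h x.
Proof.
move=> fS hS Ux; rewrite [LHS]deriveM; [|exact: smooth_derivable..].
by rewrite addrC -[X in X + _ = _]/(h x * partial i f x) mulrC.
Qed.

Lemma smooth_uptoD k f h : smooth_upto k f -> smooth_upto k h ->
  smooth_upto k (fun y => f y + h y).
Proof.
elim: k f h => [|k IH] f h fS hS; split=> //.
1,2: move=> x Ux; have [cf df] := smooth_upto_deriv fS Ux;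
   have [ch dh] := smooth_upto_deriv hS Ux.
1,2: by split=> [|i]; [exact: continuousD|exact: derivableD].
move=> i; apply: (@eq_smooth_upto k (fun y => partial i f y + partial i h y)).
  move=> y Uy; apply/esym/deriveD.
    by have [_ d] := smooth_upto_deriv fS Uy; exact: d.
  by have [_ d] := smooth_upto_deriv hS Uy; exact: d.
by apply: IH; [have [_ d] := fS; exact: d|have [_ d] := hS; exact: d].
Qed.

Lemma smooth_uptoM k f h : smooth_upto k f -> smooth_upto k h ->
  smooth_upto k (fun y => f y * h y).
Proof.
elim: k f h => [|k IH] f h fS hS; split=> //.
1,2: move=> x Ux; have [cf df] := smooth_upto_deriv fS Ux;
   have [ch dh] := smooth_upto_deriv hS Ux.
1,2: by split=> [|i]; [exact: continuousM|exact: derivableM].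
move=> i; apply: (@eq_smooth_upto k
  (fun y => f y * partial i h y + h y * partial i f y)).
  move=> y Uy; apply/esym/deriveM.
    by have [_ d] := smooth_upto_deriv fS Uy; exact: d.
  by have [_ d] := smooth_upto_deriv hS Uy; exact: d.
by apply: smooth_uptoD; apply: IH; try exact: smooth_uptoW;
  [have [_ d] := hS; exact: d|have [_ d] := fS; exact: d].
Qed.

Lemma smoothD f h : smooth_on U f -> smooth_on U h ->
  smooth_on U (fun y => f y + h y).
Proof.
move=> /smooth_onP fS /smooth_onP hS; apply/smooth_onP => k.
exact: smooth_uptoD.
Qed.

Lemma smoothM f h : smooth_on U f -> smooth_on U h ->
  smooth_on U (fun y => f y * h y).
Proof.
move=> /smooth_onP fS /smooth_onP hS; apply/smooth_onP => k.
exact: smooth_uptoM.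
Qed.

Lemma smoothV f : (forall x, U x -> f x != 0) -> smooth_on U f ->
  smooth_on U (fun y => (f y)^-1).
Proof.
move=> f0 fS; apply/smooth_onP; elim=> [|k IH]; split=> //.
1,2: move=> x Ux; have [cf df] := fS [::] x Ux.
1,2: by split=> [|i]; [apply: continuousV (f0 _ Ux) cf|apply: derivableV (f0 _ Ux) _].
have fk j : smooth_upto j f by move: j; exact/smooth_onP.
move=> i; apply: (@eq_smooth_upto k
  (fun y => (-1 * partial i f y) * ((f y)^-1 * (f y)^-1))).
  move=> y Uy; rewrite [RHS]deriveV ?f0//; last exact: smooth_derivable.
  by rewrite /GRing.scale /= -exprVn expr2 mulN1r mulNr mulrC mulNr.
apply: smooth_uptoM; last exact: smooth_uptoM.
apply: smooth_uptoM; last by have [_ d] := fk k.+1; exact: d.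
by move/smooth_onP: (smooth_cst (-1)).
Qed.

Lemma smooth_sum (I : Type) (r : seq I) (P : pred I)
    (F : I -> 'rV[R]_n -> R) :
  (forall i, smooth_on U (F i)) -> smooth_on U (fun y => \sum_(i <- r | P i) F i y).
Proof.
move=> FS; elim: r => [|i r IH].
  by under eq_fun do rewrite big_nil; exact: smooth_cst.
under eq_fun do rewrite big_cons.
by case: (P i); [exact: smoothD (FS i) IH|exact: IH].
Qed.

Lemma smooth_prod (I : Type) (r : seq I) (P : pred I)
    (F : I -> 'rV[R]_n -> R) :
  (forall i, smooth_on U (F i)) -> smooth_on U (fun y => \prod_(i <- r | P i) F i y).
Proof.
move=> FS; elim: r => [|i r IH].
  by under eq_fun do rewrite big_nil; exact: smooth_cst.
under eq_fun do rewrite big_cons.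
by case: (P i); [exact: smoothM (FS i) IH|exact: IH].
Qed.

Lemma partial_sum i (I : Type) (r : seq I) (F : I -> 'rV[R]_n -> R) x :
  (forall i, smooth_on U (F i)) -> U x ->
  partial i (fun y => \sum_(j <- r) F j y) x = \sum_(j <- r) partial i (F j) x.
Proof.
move=> FS Ux; elim: r => [|j r IH].
  by under eq_fun do rewrite big_nil; rewrite big_nil partial_cst.
under eq_fun do rewrite big_cons.
by rewrite big_cons partialD // ?IH //; exact: smooth_sum.
Qed.

End SmoothFunctions.

(** * Covariant derivatives of matrix-valued tensors *)

Section TensorCalculus.
Context {R : realType} {n N : nat}.
Variables (U : set 'rV[R]_n) (g : 'rV[R]_n -> 'M[R]_n).
Hypotheses (openU : open U) (metric_g : metric_on U g).
Implicit Types (T A B : @tensor R n 'M[R]_N).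

Lemma smooth_det k (F : 'rV[R]_n -> 'M[R]_k) :
  smooth_mx_on U F -> smooth_on U (fun x => \det (F x)).
Proof.
move=> FS; apply: (smooth_sum openU) => s.
apply: (smoothM openU); first exact: smooth_cst.
by apply: (smooth_prod openU) => i; exact: FS.
Qed.

(** A vector in the kernel of the metric would have length zero. *)
Lemma metric_unitmx x : U x -> g x \in unitmx.
Proof.
move=> /(proj2 metric_g)[_ pos]; rewrite -row_free_unit -kermx_eq0.
apply: contraT => /rowV0Pn[v /sub_kermxP vg0 /pos].
by rewrite vg0 mul0mx mxE ltxx.
Qed.

Lemma metric_sym x i j : U x -> g x i j = g x j i.
Proof. by move=> /(proj2 metric_g)[gT _]; rewrite -[in LHS]gT mxE. Qed.

Lemma invmx_metric_sym x i j : U x -> invmx (g x) i j = invmx (g x) j i.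
Proof.
by move=> /(proj2 metric_g)[gT _]; rewrite -[in LHS]gT -trmx_inv mxE.
Qed.

(** Cramer's rule: the entries of the inverse are cofactors over the determinant. *)
Lemma smooth_invmx i j : smooth_on U (fun x => invmx (g x) i j).
Proof.
apply: (@eq_smooth_on _ _ _ openU
  (fun x => (\det (g x))^-1 * cofactor (g x) j i)) => [x Ux|].
  by rewrite /invmx metric_unitmx // !mxE.
have gS := proj1 metric_g.
apply: (smoothM openU).
  apply: (smoothV openU); last exact: smooth_det.
  by move=> x Ux; rewrite -unitfE -unitmxE metric_unitmx.
apply: (smoothM openU); first exact: smooth_cst.
apply: smooth_det => p q.
by under eq_fun do rewrite !mxE; exact: gS.
Qed.

Lemma smooth_christoffel l i j : smooth_on U (christoffel g l i j).
Proof.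
have gS := proj1 metric_g.
apply: (smoothM openU); first exact: smooth_cst.
apply: (smooth_sum openU) => k; apply: (smoothM openU).
  exact: smooth_invmx.
apply: (smoothD openU); first apply: (smoothD openU).
- by apply: smooth_partial; exact: gS.
- by apply: smooth_partial; exact: gS.
apply: (@eq_smooth_on _ _ _ openU
    (fun y => -1 * partial k (fun z => g z i j) y)).
  by move=> y _; rewrite mulN1r.
apply: (smoothM openU); first exact: smooth_cst.
by apply: smooth_partial; exact: gS.
Qed.

Definition partial_mx i (F : 'rV[R]_n -> 'M[R]_N) x : 'M[R]_N :=
  \matrix_(p, q) partial i (fun y => F y p q) x.

Lemma cov_mx_nil T x : cov_mx g T [::] x = 0.
Proof. by apply/matrixP => p q; rewrite !mxE. Qed.

Lemma cov_mx_cons T i I x : cov_mx g T (i :: I) x =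
  partial_mx i (T I) x
  - \sum_(0 <= s < size I) \sum_(l < n)
      christoffel g l i (nth i I s) x *: T (set_nth i I s l) x.
Proof.
rewrite big_mkord; apply/matrixP => p q; rewrite !mxE /= summxE.
congr (_ - _); apply: eq_bigr => s _; rewrite summxE.
by apply: eq_bigr => l _; rewrite mxE.
Qed.

(** No rank is recorded in the type of tensors. Smoothness is required of the
    components on all lists of indices, and is then stable under every operation
    below; equality, on the contrary, only makes sense on lists of the right size. *)
Definition smooth_tensor T := forall I, smooth_mx_on U (T I).

Definition eq_tensor k T T' :=
  forall I x, size I = k -> U x -> T I x = T' I x.

Lemma eq_tensor_trans k T1 T2 T3 :
  eq_tensor k T1 T2 -> eq_tensor k T2 T3 -> eq_tensor k T1 T3.
Proof. by move=> e1 e2 I x sI Ux; rewrite e1 ?e2. Qed.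

Lemma eq_partial_mx i F H x : U x -> (forall y, U y -> F y = H y) ->
  partial_mx i F x = partial_mx i H x.
Proof.
move=> Ux FH; apply/matrixP => p q; rewrite !mxE.
by apply: (eq_partial openU) => // y Uy; rewrite FH.
Qed.

(** Equality is required on the whole open set, since a derivative at x depends on
    the values near x. *)
Lemma eq_cov k T T' :
  eq_tensor k T T' -> eq_tensor k.+1 (cov_mx g T) (cov_mx g T').
Proof.
move=> TT' [//|i I] x [sI] Ux; rewrite !cov_mx_cons; congr (_ - _).
  by apply: eq_partial_mx => // y Uy; rewrite TT'.
apply: eq_big_nat => s /andP[_ ltsI]; apply: eq_bigr => l _.
by rewrite TT' // size_set_nth; move/maxn_idPr: ltsI => ->.
Qed.

Lemma nablaS a T : nabla g a.+1 T = cov_mx g (nabla g a T).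
Proof. by []. Qed.

Lemma eq_nabla a k T T' :
  eq_tensor k T T' -> eq_tensor (a + k) (nabla g a T) (nabla g a T').
Proof. by move=> TT'; elim: a => [//|a IH]; exact: eq_cov IH. Qed.

Lemma smooth_partial_mx i F :
  smooth_mx_on U F -> smooth_mx_on U (partial_mx i F).
Proof.
move=> FS p q; apply: (eq_smooth_on openU _ (smooth_partial i (FS p q))).
by move=> y _; rewrite mxE.
Qed.

Lemma smooth_mxD F H : smooth_mx_on U F -> smooth_mx_on U H ->
  smooth_mx_on U (fun x => F x + H x :> 'M[R]_N).
Proof.
by move=> FS HS p q; under eq_fun do rewrite mxE; exact: (smoothD openU).
Qed.

Lemma smooth_mx_cst (C : 'M[R]_N) : smooth_mx_on U (fun=> C).
Proof. by move=> p q; exact: smooth_cst. Qed.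

Lemma smooth_mxZ (f : 'rV[R]_n -> R) F : smooth_on U f -> smooth_mx_on U F ->
  smooth_mx_on U (fun x => f x *: F x :> 'M[R]_N).
Proof.
by move=> fS FS p q; under eq_fun do rewrite mxE; exact: smoothM (FS p q).
Qed.

Lemma smooth_mxM F H : smooth_mx_on U F -> smooth_mx_on U H ->
  smooth_mx_on U (fun x => F x * H x :> 'M[R]_N).
Proof.
move=> FS HS p q; under eq_fun do rewrite mxE.
by apply: (smooth_sum openU) => r; exact: (smoothM openU).
Qed.

Lemma smooth_mxN F : smooth_mx_on U F ->
  smooth_mx_on U (fun x => - F x :> 'M[R]_N).
Proof.
move=> FS; under eq_fun do rewrite -scaleN1r.
by apply: smooth_mxZ => //; exact: smooth_cst.
Qed.

Lemma smooth_mx_sum (J : Type) (r : seq J) (F : J -> 'rV[R]_n -> 'M[R]_N) :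
  (forall j, smooth_mx_on U (F j)) ->
  smooth_mx_on U (fun x => \sum_(j <- r) F j x).
Proof.
move=> FS p q; under eq_fun do rewrite summxE.
by apply: (smooth_sum openU) => j; exact: FS.
Qed.

Lemma smooth_cov T : smooth_tensor T -> smooth_tensor (cov_mx g T).
Proof.
move=> TS [|i I].
  have -> : cov_mx g T [::] = fun=> 0 by apply/funext => x; rewrite cov_mx_nil.
  exact: smooth_mx_cst.
have -> : cov_mx g T (i :: I) = (fun x => partial_mx i (T I) x
    - \sum_(0 <= s < size I) \sum_(l < n)
        christoffel g l i (nth i I s) x *: T (set_nth i I s l) x).
  by apply/funext => x; rewrite cov_mx_cons.
apply: smooth_mxD; first exact/smooth_partial_mx/TS.
apply: smooth_mxN; apply: smooth_mx_sum => s; apply: smooth_mx_sum => l.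
by apply: smooth_mxZ (TS _); exact: smooth_christoffel.
Qed.

Lemma smooth_nabla a T : smooth_tensor T -> smooth_tensor (nabla g a T).
Proof. by move=> TS; elim: a => [//|a IH]; exact: smooth_cov. Qed.

Lemma partial_mxD i F H x : smooth_mx_on U F -> smooth_mx_on U H -> U x ->
  partial_mx i (fun y => F y + H y) x = partial_mx i F x + partial_mx i H x.
Proof.
move=> FS HS Ux; apply/matrixP => p q; rewrite !mxE -(partialD (U := U)) //.
by under eq_fun do rewrite mxE.
Qed.

Lemma partial_mxM i F H x : smooth_mx_on U F -> smooth_mx_on U H -> U x ->
  partial_mx i (fun y => F y * H y) x
  = partial_mx i F x * H x + F x * partial_mx i H x.
Proof.
move=> FS HS Ux; apply/matrixP => p q; rewrite !mxE -big_split /=.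
under eq_fun do rewrite mxE.
rewrite (partial_sum openU) //; last first.
  by move=> r; apply: (smoothM openU); [exact: FS|exact: HS].
by apply: eq_bigr => r _; rewrite (partialM (U := U)) // !mxE.
Qed.

Lemma partial_mxZ i f F x : smooth_on U f -> smooth_mx_on U F -> U x ->
  partial_mx i (fun y => f y *: F y) x
  = partial i f x *: F x + f x *: partial_mx i F x.
Proof.
move=> fS FS Ux; apply/matrixP => p q; rewrite !mxE.
under eq_fun do rewrite mxE.
exact: partialM fS (FS p q) Ux.
Qed.

Lemma partial_mx_sum i (J : Type) (r : seq J) (F : J -> 'rV[R]_n -> 'M[R]_N) x :
  (forall j, smooth_mx_on U (F j)) -> U x ->
  partial_mx i (fun y => \sum_(j <- r) F j y) x
  = \sum_(j <- r) partial_mx i (F j) x.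
Proof.
move=> FS Ux; apply/matrixP => p q; rewrite !mxE summxE.
under eq_fun do rewrite summxE.
rewrite (partial_sum openU) => [|j|//]; last exact: FS.
by apply: eq_bigr => j _; rewrite mxE.
Qed.

Lemma partial_mx_cst i (C : 'M[R]_N) x : partial_mx i (fun=> C) x = 0.
Proof. by apply/matrixP => p q; rewrite !mxE partial_cst. Qed.

Lemma covD T T' I x : smooth_tensor T -> smooth_tensor T' -> U x ->
  cov_mx g (fun I y => T I y + T' I y) I x
  = cov_mx g T I x + cov_mx g T' I x.
Proof.
move=> TS TS' Ux; case: I => [|i I]; first by rewrite !cov_mx_nil addr0.
rewrite !cov_mx_cons partial_mxD // addrACA -opprD -big_split /=.
congr (_ - _); apply: eq_bigr => s _; rewrite -big_split /=.
by apply: eq_bigr => l _; rewrite scalerDr.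
Qed.

Lemma nablaD a k T T' : smooth_tensor T -> smooth_tensor T' ->
  eq_tensor k (nabla g a (fun I y => T I y + T' I y))
    (fun I x => nabla g a T I x + nabla g a T' I x).
Proof.
move=> TS TS'; elim: a k => [//|a IH] [|k] I x sI Ux.
  by case: I sI => // _; rewrite !nablaS !cov_mx_nil addr0.
rewrite !nablaS -(covD I (smooth_nabla a TS) (smooth_nabla a TS') Ux).
exact: (eq_cov (IH k)).
Qed.

Lemma cov0 k : eq_tensor k (cov_mx g (fun _ _ => 0)) (fun _ _ => 0).
Proof.
case=> [|i I] x _ Ux; first exact: cov_mx_nil.
rewrite cov_mx_cons partial_mx_cst big1 ?subr0 // => s _.
by rewrite big1 // => l _; rewrite scaler0.
Qed.

Lemma nabla0 a k : eq_tensor k (nabla g a (fun _ _ => 0)) (fun _ _ => 0).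
Proof.
elim: a k => [//|a IH] [|k] I x sI Ux.
  by case: I sI => // _; rewrite nablaS cov_mx_nil.
by rewrite nablaS (eq_cov (IH k)) // (@cov0 k.+1).
Qed.

Lemma nablaN a k T : smooth_tensor T ->
  eq_tensor k (nabla g a (fun I y => - T I y))
    (fun I x => - nabla g a T I x).
Proof.
move=> TS I x sI Ux; apply/eqP; rewrite -addr_eq0; apply/eqP.
have TSN : smooth_tensor (fun I y => - T I y) by move=> K; exact: smooth_mxN.
rewrite -(@nablaD a k _ _ TSN TS I x) //.
have -> : (fun K y => - T K y + T K y) = (fun _ _ => 0).
  by apply/funext => K; apply/funext => y; rewrite addNr.
exact: (@nabla0 a k).
Qed.

Definition tensor_mul b A B : tensor 'M[R]_N :=
  fun I x => A (take b I) x * B (drop b I) x.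

Lemma smooth_tensor_mul b A B :
  smooth_tensor A -> smooth_tensor B -> smooth_tensor (tensor_mul b A B).
Proof. by move=> AS BS I; exact: smooth_mxM. Qed.

Lemma tensor_mulE b A B I1 I2 x : size I1 = b ->
  tensor_mul b A B (I1 ++ I2) x = A I1 x * B I2 x.
Proof. by move=> <-; rewrite /tensor_mul take_size_cat ?drop_size_cat. Qed.

Lemma set_nth_cat (S : Type) (d : S) I1 I2 s l : set_nth d (I1 ++ I2) s l =
  if (s < size I1)%N then set_nth d I1 s l ++ I2
  else I1 ++ set_nth d I2 (s - size I1) l.
Proof.
elim: I1 s => [|i I1 IH] s /=; first by rewrite subn0.
by case: s => [//|s] /=; rewrite IH ltnS subSS; case: ifP.
Qed.

(** In the Christoffel sum the indices of the two factors are corrected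
    separately, which gives the two halves of the Leibniz rule. *)
Lemma cov_tensor_mul b A B i I1 I2 x :
  smooth_tensor A -> smooth_tensor B -> U x -> size I1 = b ->
  cov_mx g (tensor_mul b A B) (i :: I1 ++ I2) x =
  cov_mx g A (i :: I1) x * B I2 x + A I1 x * cov_mx g B (i :: I2) x.
Proof.
move=> AS BS Ux sI1; rewrite !cov_mx_cons.
rewrite (@eq_partial_mx i _ (fun y => A I1 y * B I2 y)) //; last first.
  by move=> y _; rewrite tensor_mulE.
rewrite partial_mxM // mulrBl mulrBr addrACA -opprD; congr (_ - _).
rewrite size_cat (@big_cat_nat _ _ _ (size I1)) ?leq_addr //=; congr (_ + _).
  rewrite mulr_suml; apply: eq_big_nat => s /andP[_ lts].
  rewrite mulr_suml; apply: eq_bigr => l _.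
  rewrite nth_cat set_nth_cat lts tensor_mulE ?scalemxAl //.
  by rewrite size_set_nth; move/maxn_idPr: lts => ->.
rewrite -{1}[size I1]add0n big_addn addKn mulr_sumr.
apply: eq_big_nat => s _; rewrite mulr_sumr; apply: eq_bigr => l _.
rewrite nth_cat set_nth_cat ltnNge leq_addl /= addnK tensor_mulE //.
exact: scalemxAr.
Qed.

End TensorCalculus.

(** * Rearrangements of indices *)

Section Rearrangements.

(** A permutation of the positions in a list, given as a function on lists that is
    natural in the type of the entries. This form avoids permutations of a
    fixed ordinal type, hence casts between equal ranks. *)
Definition rearrangement (rho : forall S : Type, seq S -> seq S) :=
  (forall (S S' : Type) (f : S -> S') I, rho S' (map f I) = map f (rho S I)) /\
  (forall (S : eqType) (I : seq S), perm_eq (rho S I) I).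

(** The effect of a rearrangement after a more covariant derivatives, whose
    indices come first. *)
Definition shift a (rho : forall S : Type, seq S -> seq S) S (I : seq S) :=
  take a I ++ rho S (drop a I).

Lemma rearrangement_shift a rho : rearrangement rho -> rearrangement (shift a rho).
Proof.
move=> [nat_rho perm_rho]; split=> [S S' f I|S I].
  by rewrite /shift -map_drop nat_rho map_cat map_take.
by rewrite -[X in perm_eq _ X](cat_take_drop a) perm_cat2l perm_rho.
Qed.

(** The index of the derivative that the Leibniz rule sends to the second factor
    has to pass the b indices of the first one. *)
Definition move_head b S (I : seq S) :=
  if I is i :: I' then take b I' ++ i :: drop b I' else [::].

Lemma rearrangement_move_head b : rearrangement (move_head b).
Proof.
split=> [S S' f [//|i I]|S [//|i I]] /=.
  by rewrite map_cat map_take /= map_drop.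
by rewrite perm_catC /= perm_cons perm_catC cat_take_drop.
Qed.

Definition swap_blocks b S (I : seq S) := drop b I ++ take b I.

Lemma rearrangement_swap_blocks b : rearrangement (swap_blocks b).
Proof.
split=> [S S' f I|S I]; first by rewrite /swap_blocks map_cat map_drop map_take.
by rewrite perm_catC cat_take_drop.
Qed.

Definition rotrev b S (I : seq S) := drop b I ++ rev (take b I).

Lemma rearrangement_rotrev b : rearrangement (rotrev b).
Proof.
split=> [S S' f I|S I].
  by rewrite /rotrev map_cat map_drop map_rev map_take.
by rewrite perm_catC -[X in perm_eq _ X](cat_take_drop b) perm_cat2r perm_rev.
Qed.

(** Apply the rearrangement to the list of all positions; by naturality this
    determines it on every list of that size. *)
Lemma rearrangement_perm rho k : rearrangement rho -> exists tau : 'S_k,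
  forall S (t : k.-tuple S), rho S t = [tuple tnth t (tau r) | r < k].
Proof.
move=> [nat_rho perm_rho]; pose p := rho _ (enum 'I_k).
have pE : perm_eq p (enum 'I_k) by exact: perm_rho.
have sp : size p == k by rewrite (perm_size pE) size_enum_ord.
have up : uniq p by rewrite (perm_uniq pE) enum_uniq.
have tau_inj : injective (tnth (Tuple sp)) by apply/tuple_uniqP.
exists (perm tau_inj) => S t.
have tE (S' : Type) (u : k.-tuple S') :
    tval u = [seq tnth u r | r <- enum 'I_k] := congr1 val (tuple_map_ord u).
rewrite {1}tE nat_rho -/p.
transitivity [seq tnth t r | r <- [seq tnth (Tuple sp) r | r <- enum 'I_k]].
  by rewrite -tE.
rewrite -map_comp.
by apply: eq_map => r /=; rewrite permE.
Qed.

Lemma is_pairing_conj k (sigma tau : 'S_k) :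
  is_pairing sigma -> is_pairing (tau * sigma * tau^-1)%g.
Proof.
move=> pair r; rewrite !permM !permKV; have [sK ne] := pair (tau r).
rewrite sK permK; split; first by [].
by apply: contra_neq ne => /(congr1 tau); rewrite permKV.
Qed.

End Rearrangements.

Section Contractions.
Context {R : realType} {n N : nat}.
Variables (U : set 'rV[R]_n) (g : 'rV[R]_n -> 'M[R]_n).
Hypotheses (openU : open U) (metric_g : metric_on U g).
Implicit Types (T A B : @tensor R n 'M[R]_N).

(** The Christoffel sum runs over the positions, and a rearrangement only changes
    the order of its terms. *)
Lemma cov_rearrangement rho T i I x : rearrangement rho ->
  cov_mx g (fun I y => T (rho _ I) y) (i :: I) x = cov_mx g T (i :: rho _ I) x.
Proof.
move=> [nat_rho perm_rho]; rewrite !cov_mx_cons; congr (_ - _).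
set p := rho _ (iota 0 (size I)).
have pE : perm_eq p (iota 0 (size I)) by exact: perm_rho.
have up : uniq p by rewrite (perm_uniq pE) iota_uniq.
have sp : size p = size I by rewrite (perm_size pE) size_iota.
have rhoE K : size K = size I -> rho _ K = map (nth i K) p.
  by move=> sK; rewrite -{1}(mkseq_nth i K) /mkseq nat_rho sK.
rewrite (perm_size (perm_rho _ I)) [in LHS]/index_iota subn0 -(perm_big _ pE) /=.
rewrite (big_nth 0%N) sp; apply: eq_big_nat => r /andP[_ ltr].
have ltpr : (nth 0%N p r < size I)%N.
  by have := mem_nth 0%N (s := p) (n := r); rewrite sp (perm_mem pE) mem_iota => /(_ ltr).
rewrite (rhoE I) // (nth_map 0%N) ?sp //; apply: eq_bigr => l _; congr (_ *: T _ _).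
have sK : size (set_nth i I (nth 0%N p r) l) = size I.
  by rewrite size_set_nth; move/maxn_idPr: ltpr => ->.
rewrite rhoE //; apply: (@eq_from_nth _ i) => [|q].
  by rewrite size_set_nth !size_map sp; move/maxn_idPr: ltr => ->.
rewrite size_map sp => ltq; rewrite (nth_map 0%N) ?sp // !nth_set_nth /=.
by rewrite nth_uniq ?sp // (nth_map 0%N) ?sp.
Qed.

Lemma nabla_rearrangement a rho T : rearrangement rho ->
  nabla g a (fun I y => T (rho _ I) y) = fun I x => nabla g a T (shift a rho I) x.
Proof.
move=> rho_re; elim: a => [|a IH].
  by apply/funext => I; apply/funext => x; rewrite /shift take0 drop0.
apply/funext => -[|i I]; apply/funext => x; rewrite nablaS.
  have /perm_nilP : perm_eq (shift a.+1 rho [::] : seq 'I_n) [::].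
    by have [_] := rearrangement_shift a.+1 rho_re; exact.
  by move=> ->; rewrite nablaS !cov_mx_nil.
by rewrite IH (cov_rearrangement _ _ _ _ (rearrangement_shift a rho_re)).
Qed.

(** Each pair of the involution contributes one factor, whichever of its two
    elements represents it: the representative smallest for one order can be
    replaced by the one smallest for another. *)
Lemma prod_involution k (f : 'I_k -> 'I_k -> R) (sigma tau : 'S_k) :
  is_pairing sigma -> (forall q r, f q r = f r q) ->
  \prod_(q < k | (tau q < tau (sigma q))%N) f q (sigma q)
  = \prod_(q < k | (q < sigma q)%N) f q (sigma q).
Proof.
move=> pair f_sym.
have ltC (e : 'S_k) (q : 'I_k) : (e (sigma q) < e q)%N = ~~ (e q < e (sigma q))%N.
  rewrite ltn_neqAle leqNgt andb_idl // => _.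
  by rewrite (inj_eq val_inj) (inj_eq perm_inj); have [] := pair q.
have lt1 q : (sigma q < q)%N = ~~ (q < sigma q)%N.
  by have := ltC 1%g q; rewrite !perm1.
rewrite (bigID (fun q : 'I_k => q < sigma q)%N).
rewrite [RHS](bigID (fun q => tau q < tau (sigma q))%N) /=.
congr (_ * _); first by apply: eq_bigl => q; rewrite andbC.
rewrite (reindex_inj (@perm_inj _ sigma)) /=.
apply: eq_big => [q|q _]; have [-> _] := pair q; last exact: f_sym.
by rewrite ltC lt1 negbK andbC.
Qed.

(** Rearranging the indices of a tensor amounts to conjugating the pairing that
    contracts it. *)
Lemma contract_tuple k (sigma tau : 'S_k) T T' x : is_pairing sigma -> U x ->
  (forall t : k.-tuple 'I_n, T' t x = T [tuple tnth t (tau r) | r < k] x) ->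
  Defs.contract g sigma T' x = Defs.contract g (tau * sigma * tau^-1)%g T x.
Proof.
move=> pair Ux T'E; rewrite /Defs.contract.
pose h (e : 'S_k) (t : k.-tuple 'I_n) := [tuple tnth t (e r) | r < k].
have hK (e e' : 'S_k) : (forall r, e' (e r) = r) -> cancel (h e') (h e).
  move=> eK t; apply: eq_from_tnth => r; rewrite !tnth_mktuple.
  by rewrite eK.
rewrite (reindex (h (tau^-1)%g)); last first.
  by exists (h tau) => t _; apply: hK => r; rewrite ?permK ?permKV.
apply: eq_bigr => t _; rewrite T'E; congr (_ *: T _ x); last first.
  exact: (congr1 val (hK tau (tau^-1)%g (permK tau) t)).
pose f q r := invmx (g x) (tnth t q) (tnth t r).
have pair' := is_pairing_conj tau pair.
rewrite -(@prod_involution _ f _ tau) //; last first.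
  by move=> q r; exact: (invmx_metric_sym metric_g).
rewrite (reindex_inj (@perm_inj _ tau)) /=.
apply: eq_big => [q|q _]; rewrite !permM ?permKV //.
by rewrite !tnth_mktuple permK.
Qed.

End Contractions.

(** * The metric is parallel *)

Section MetricTraces.
Context {R : realType} {n : nat}.
Variables (U : set 'rV[R]_n) (g : 'rV[R]_n -> 'M[R]_n).
Hypotheses (openU : open U) (metric_g : metric_on U g).

Lemma partial_invmx k x : U x ->
  partial_mx k (fun y => invmx (g y)) x
  = - (invmx (g x) * partial_mx k g x * invmx (g x)).
Proof.
move=> Ux; have gS : smooth_mx_on U g := proj1 metric_g.
have iS : smooth_mx_on U (fun y => invmx (g y)).
  by move=> i j; exact: smooth_invmx.
have : partial_mx k (fun y => invmx (g y) * g y) x = 0.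
  rewrite -(partial_mx_cst k 1%:M x).
  by apply: (eq_partial_mx openU) => // y Uy; apply: mulVmx; exact: metric_unitmx Uy.
rewrite (partial_mxM openU) // => /eqP; rewrite addr_eq0 => /eqP.
move=> /(congr1 (fun M => M * invmx (g x))).
have gV : g x * invmx (g x) = 1 by apply: mulmxV; exact: metric_unitmx Ux.
by rewrite -[X in X = _ -> _]mulrA gV mulr1 mulNr.
Qed.

(** The inverse metric is parallel. From G g = 1, the derivative of the inverse G
    is - G (dg) G, and the two Christoffel symbols add up to dg because the other
    derivatives of the metric cancel by symmetry. *)
Lemma metric_compatibility k i j x : U x ->
  partial k (fun y => invmx (g y) i j) x
  = - \sum_(l < n) (christoffel g i k l x * invmx (g x) l j
                    + christoffel g j k l x * invmx (g x) i l).
Proof.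
move=> Ux; have := partial_invmx k Ux.
move=> /(congr1 (fun M => fun_of_matrix M i j)); rewrite [LHS]mxE => ->.
rewrite [LHS]mxE [X in - X]mxE; congr (- _).
pose G := invmx (g x); pose d p q r := partial p (fun y => g y q r) x.
have Gs p q : G p q = G q p by exact: (invmx_metric_sym metric_g).
have ds p q r : d p q r = d p r q.
  by apply: (eq_partial openU) => // y Uy; exact: (metric_sym metric_g).
transitivity (\sum_(l < n) \sum_(p < n) G i p * d k p l * G l j).
  by apply: eq_bigr => l _; rewrite mxE mulr_suml; apply: eq_bigr => p _; rewrite mxE.
pose c l p : R := 2^-1 * G i p * (d k l p + d l k p - d p k l) * G l j.
pose c' l p : R := 2^-1 * G j p * (d k l p + d l k p - d p k l) * G i l.
transitivity (\sum_(l < n) \sum_(p < n) c l p + \sum_(l < n) \sum_(p < n) c' l p).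
  rewrite [X in _ = _ + X]exchange_big -big_split; apply: eq_bigr => l _ /=.
  rewrite -big_split; apply: eq_bigr => p _ /=; rewrite /c /c'.
  by rewrite (Gs j l) (ds k p l) /d; field.
rewrite -big_split; apply: eq_bigr => l _ /=; rewrite /christoffel !mulr_sumr !mulr_suml.
by congr (_ + _); apply: eq_bigr => p _; rewrite /c /c' /G /d !mulrA.
Qed.

Context {N : nat}.
Implicit Types (T : @tensor R n 'M[R]_N).

(** The trace is taken over the last two indices, so that it does not interfere
    with the indices of derivatives, which are added at the front. *)
Definition trace2 T : tensor 'M[R]_N := fun I x =>
  \sum_(i < n) \sum_(j < n) invmx (g x) i j *: T (I ++ [:: i; j]) x.

Lemma smooth_trace2 T : smooth_tensor U T -> smooth_tensor U (trace2 T).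
Proof.
move=> TS I; apply: (smooth_mx_sum openU) => i.
apply: (smooth_mx_sum openU) => j; apply: (smooth_mxZ openU _ (TS _)).
exact: smooth_invmx.
Qed.

(** The Christoffel terms of the two traced indices cancel the derivative of the
    inverse metric. *)
Lemma cov_trace2 T i I x : smooth_tensor U T -> U x ->
  cov_mx g (trace2 T) (i :: I) x = trace2 (cov_mx g T) (i :: I) x.
Proof.
move=> TS Ux; pose G p q := invmx (g x) p q; pose t p q := T (I ++ [:: p; q]) x.
pose c l p := christoffel g l i p x.
pose d p q := partial_mx i (T (I ++ [:: p; q])) x.
pose s p q := \sum_(0 <= r < size I) \sum_(l < n)
  c l (nth i I r) *: T (set_nth i I r l ++ [:: p; q]) x.
have iS p q : smooth_on U (fun y => invmx (g y) p q) by exact: smooth_invmx.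
have -> : cov_mx g (trace2 T) (i :: I) x =
    \sum_p \sum_q partial i (fun y => invmx (g y) p q) x *: t p q
    + (\sum_p \sum_q G p q *: d p q - \sum_p \sum_q G p q *: s p q).
  rewrite addrA cov_mx_cons /trace2; congr (_ - _).
    have GTS p q :
        smooth_mx_on U (fun y => invmx (g y) p q *: T (I ++ [:: p; q]) y).
      exact: (smooth_mxZ openU (iS p q) (TS _)).
    rewrite (partial_mx_sum openU) => [|p|//]; last first.
      exact: (smooth_mx_sum openU _ (GTS p)).
    rewrite -big_split; apply: eq_bigr => p _ /=.
    rewrite (partial_mx_sum openU _ _ (GTS p)) // -big_split.
    by apply: eq_bigr => q _; exact: (partial_mxZ _ (iS p q) (TS _) Ux).
  rewrite [RHS](eq_bigr (fun p => \sum_(0 <= r < size I) \sum_l \sum_q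
      c l (nth i I r) *: (G p q *: T (set_nth i I r l ++ [:: p; q]) x))).
    rewrite [RHS]exchange_big; apply: eq_bigr => r _; rewrite [RHS]exchange_big.
    by apply: eq_bigr => l _; rewrite scaler_sumr; apply: eq_bigr => p _;
      rewrite scaler_sumr.
  move=> p _; rewrite /s.
  under eq_bigr => q _ do rewrite scaler_sumr.
  rewrite exchange_big; apply: eq_bigr => r _.
  under eq_bigr => q _ do rewrite scaler_sumr.
  rewrite exchange_big; apply: eq_bigr => l _; apply: eq_bigr => q _.
  by rewrite !scalerA mulrC.
have -> : trace2 (cov_mx g T) (i :: I) x =
    \sum_p \sum_q G p q *: (d p q - (s p q
      + \sum_l c l p *: t l q + \sum_l c l q *: t p l)).
  apply: eq_bigr => p _; apply: eq_bigr => q _; congr (_ *: _).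
  rewrite cat_cons cov_mx_cons size_cat addn2 !big_nat_recr //=.
  congr (_ - _); congr (_ + _); first congr (_ + _).
  - apply: eq_big_nat => r /andP[_ ltr].
    by apply: eq_bigr => l _; rewrite nth_cat set_nth_cat ltr.
  - by apply: eq_bigr => l _; rewrite nth_cat set_nth_cat ltnn subnn.
  - apply: eq_bigr => l _.
    by rewrite nth_cat set_nth_cat ltnNge leqnSn /= subSnn.
have -> : \sum_p \sum_q partial i (fun y => invmx (g y) p q) x *: t p q
   = - \sum_p \sum_q (G p q *: (\sum_l c l p *: t l q)
      + G p q *: (\sum_l c l q *: t p l)).
  pose F p q l := (c p l * G l q) *: t p q.
  pose F' p q l := (c q l * G p l) *: t p q.
  transitivity (- (\sum_p \sum_q \sum_l F p q l + \sum_p \sum_q \sum_l F' p q l)).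
    rewrite -big_split -sumrN; apply: eq_bigr => p _ /=.
    rewrite -big_split -sumrN; apply: eq_bigr => q _ /=.
    rewrite metric_compatibility // scaleNr scaler_suml -big_split; congr (- _).
    by apply: eq_bigr => l _ /=; rewrite scalerDl.
  congr (- _).
  have -> : \sum_p \sum_q \sum_l F p q l = \sum_p \sum_q \sum_l F l q p.
    under eq_bigr => p _ do rewrite exchange_big.
    rewrite exchange_big; apply: eq_bigr => l _.
    by rewrite exchange_big.
  rewrite -big_split; apply: eq_bigr => p _ /=.
  rewrite [X in _ + X]exchange_big -big_split; apply: eq_bigr => q _ /=.
  rewrite !scaler_sumr; congr (_ + _); apply: eq_bigr => l _.
    by rewrite scalerA mulrC.
  by rewrite scalerA mulrC.
rewrite -!sumrB -sumrN -big_split; apply: eq_bigr => p _ /=.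
rewrite -!sumrB -sumrN -big_split; apply: eq_bigr => q _ /=.
by rewrite scalerBr !scalerDr [LHS]addrC -[LHS]addrA -opprD [X in - X]addrA.
Qed.

Lemma eq_trace2 k T T' :
  eq_tensor U k.+2 T T' -> eq_tensor U k (trace2 T) (trace2 T').
Proof.
move=> TT' I x sI Ux; apply: eq_bigr => i _; apply: eq_bigr => j _.
by rewrite TT' // size_cat sI addn2.
Qed.

Lemma smooth_traces a T :
  smooth_tensor U T -> smooth_tensor U (iter a trace2 T).
Proof. by move=> TS; elim: a => [//|a IH]; exact: smooth_trace2. Qed.

Lemma nabla_traces a b k T : smooth_tensor U T ->
  eq_tensor U (a + k) (nabla g a (iter b trace2 T)) (iter b trace2 (nabla g a T)).
Proof.
move=> TS; elim: b k => [//|b IHb] k.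
apply: (@eq_tensor_trans _ _ _ _ _ _ (trace2 (nabla g a (iter b trace2 T)))).
  elim: a {IHb} k => [//|a IH] k I x sI Ux.
  rewrite nablaS (eq_cov g openU (IH k)) //.
  case: I sI => [//|i I _].
  apply: cov_trace2 Ux; apply: (smooth_nabla openU metric_g); exact: smooth_traces.
by apply: eq_trace2; rewrite -!addnS; exact: IHb.
Qed.

Lemma laplace_mxE F : laplace_mx g F = trace2 (nabla_fun g 2 F) [::].
Proof.
apply/funext => x; apply/matrixP => p q; rewrite !mxE summxE.
apply: eq_bigr => i _; rewrite summxE; apply: eq_bigr => j _.
rewrite mxE -[nabla_fun _ _ _ _ _]/(cov_mx g (nabla_fun g 1 F) [:: i; j] x) mxE.
have -> : (fun K y => nabla_fun g 1 F K y p q) = cov g (fun _ y => F y p q).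
  by apply/funext => K; apply/funext => y; rewrite mxE.
by [].
Qed.

(** Traces can be moved outside covariant derivatives, so the iterated
    Laplacian is an iterated trace of the full derivative. *)
Lemma laplace_powE m F x : smooth_mx_on U F -> U x ->
  laplace_pow g m F x = iter m trace2 (nabla_fun g m.*2 F) [::] x.
Proof.
move=> FS; elim: m x => [//|m IH] x Ux.
have TS : smooth_tensor U (nabla_fun g m.*2 F).
  by apply: (smooth_nabla openU metric_g) => I.
rewrite [laplace_pow _ _ _]/= laplace_mxE iterS.
apply: (eq_trace2 (k := 0)) => // I y sI Uy.
rewrite [nabla_fun g 2 _]/nabla_fun.
rewrite (@eq_nabla _ _ _ _ g openU 2 0 _ (iter m trace2 (nabla_fun g m.*2 F))) //.
  by rewrite (@nabla_traces 2 m 0 _ TS) // /nabla_fun /nabla -iterD.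
by move=> K z sK Uz; rewrite IH //; case: K sK.
Qed.

End MetricTraces.

(** * The contraction that defines a power of the Laplacian *)

Section StandardPairing.

(** The exchange of 0 with 1, of 2 with 3, and so on. *)
Definition flip_nat r := if odd r then r.-1 else r.+1.

Lemma flip_nat_lt m r : (r < m.*2)%N -> (flip_nat r < m.*2)%N.
Proof. by rewrite /flip_nat; case: ifP; lia. Qed.

Lemma flip_natK : involutive flip_nat.
Proof. by move=> r; rewrite /flip_nat; case: ifP; case: ifP; lia. Qed.

Definition flip m (r : 'I_(m.*2)) := Ordinal (flip_nat_lt (ltn_ord r)).

Lemma flipK m : involutive (@flip m).
Proof. by move=> r; apply/val_inj/flip_natK. Qed.

Definition standard_pairing m : 'S_(m.*2) := perm (inv_inj (@flipK m)).

Lemma is_pairing_standard m : is_pairing (standard_pairing m).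
Proof.
move=> r; rewrite !permE flipK; split; first by []; apply/eqP => /(congr1 val) /=.
by rewrite /flip_nat; case: ifP; lia.
Qed.

Context {R : realType} {n N : nat}.
Variables (U : set 'rV[R]_n) (g : 'rV[R]_n -> 'M[R]_n).
Hypotheses (openU : open U) (metric_g : metric_on U g).
Implicit Types (T : @tensor R n 'M[R]_N).

Lemma sum_tuple_cons (S : finType) (V : nmodType) k (F : seq S -> V) :
  \sum_(t : k.+1.-tuple S) F t = \sum_i \sum_(t : k.-tuple S) F (i :: t).
Proof.
rewrite pair_bigA (reindex (fun p : S * k.-tuple S => cons_tuple p.1 p.2)) //=.
exists (fun t : k.+1.-tuple S => (thead t, behead_tuple t)) => [[i t] _|t _] /=.
  by congr (_, _); apply: val_inj.
by apply: val_inj; case: t => -[].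
Qed.

Fixpoint pair_weight (G : 'M[R]_n) (I : seq 'I_n) : R :=
  if I is i :: j :: I' then G i j * pair_weight G I' else 1.

Lemma iter_trace2 m T I x : iter m (trace2 g) T I x =
  \sum_(t : m.*2.-tuple 'I_n) pair_weight (invmx (g x)) t *: T (I ++ t) x.
Proof.
elim: m I => [|m IH] I.
  rewrite (big_pred1 [tuple]) => [|t]; last by rewrite [t]tuple0; exact/esym/eqP.
  by rewrite scale1r cats0.
rewrite iterS /trace2 doubleS.
rewrite (sum_tuple_cons _ (fun t => pair_weight (invmx (g x)) t *: T (I ++ t) x)).
apply: eq_bigr => i _.
rewrite (sum_tuple_cons _
  (fun t => pair_weight (invmx (g x)) (i :: t) *: T (I ++ i :: t) x)).
apply: eq_bigr => j _; rewrite IH scaler_sumr; apply: eq_bigr => t _.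
by rewrite scalerA -catA.
Qed.

Lemma prod_pair_weight (G : 'M[R]_n) d m I : size I = m.*2 ->
  \prod_(0 <= r < m.*2 | ~~ odd r) G (nth d I r) (nth d I r.+1)
  = pair_weight G I.
Proof.
elim: m I => [|m IH] I; first by move=> /size0nil ->; rewrite big_nil.
case: I => [//|i [//|j I]] sI; rewrite big_mkcond doubleS !big_nat_recl //= mul1r.
rewrite -IH; last by case: sI.
rewrite [in RHS]big_mkcond; congr (_ * _).
by apply: eq_bigr => r _; rewrite negbK.
Qed.

Lemma contract_standard m T x :
  Defs.contract g (standard_pairing m) T x = iter m (trace2 g) T [::] x.
Proof.
rewrite iter_trace2; apply: eq_bigr => t _; congr (_ *: _).
case: m t => [|m] t; first by rewrite tuple0 big_ord0.
rewrite -(@prod_pair_weight _ (thead t) m.+1) ?size_tuple // big_mkord.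
apply: eq_big => [r|r]; rewrite permE /= /flip_nat.
  by case: ifP; lia.
rewrite !(tnth_nth (thead t)) /= /flip_nat; case: ifP => [_ lt|_ _ //].
by exfalso; lia.
Qed.

(** The reversal of an even number of positions commutes with [flip_nat]. *)
Lemma contract_standard_rev m T x : U x ->
  Defs.contract g (standard_pairing m) (fun I => T (rev I)) x
  = Defs.contract g (standard_pairing m) T x.
Proof.
move=> Ux; pose tau := perm (@rev_ord_inj m.*2).
rewrite (@contract_tuple _ _ _ _ _ metric_g _ _ tau T) //.
- congr Defs.contract; apply/permP => r; rewrite !permM; apply: (canLR (permK _)).
  rewrite !permE; apply: val_inj; rewrite /= /flip_nat; have := ltn_ord r.
  by case: ifP; case: ifP; lia.
- exact: is_pairing_standard.
- move=> t; congr (T _ x); apply: (congr1 val (x := [tuple of rev t])).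
  apply: eq_from_tnth => r; rewrite tnth_mktuple permE.
  by have d := tnth t r; rewrite !(tnth_nth d) /= nth_rev size_tuple.
Qed.

End StandardPairing.

(** * Tensor expressions over all data of the theorem *)

Section UnitBall.
Context {R : realType} {n : nat}.

Lemma open_unit_ball : open (@unit_ball R n).
Proof.
pose f (x : 'rV[R]_n) := \sum_(i < n) x 0 i ^+ 2.
have cf : continuous f.
  apply: continuous_big; first exact: add_continuous.
  by move=> i _ x; apply: continuousM; exact: coord_continuous.
have -> : @unit_ball R n = (f @^-1` [set y | y < 1])%classic by [].
by apply: open_comp; [move=> x _; exact: cf|exact: open_lt].
Qed.

End UnitBall.

Section Constants.
Context {R : realType} {n N : nat}.
Variables (U : set 'rV[R]_n) (g : 'rV[R]_n -> 'M[R]_n).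
Hypotheses (openU : open U) (metric_g : metric_on U g).
Implicit Types (T : @tensor R n 'M[R]_N) (C : 'M[R]_N).

Lemma bracketD C A B : bracket C (A + B) = bracket C A + bracket C B :> 'M[R]_N.
Proof. by rewrite /bracket mulrDr mulrDl opprD addrACA. Qed.

Lemma bracketN C A : bracket C (- A) = - bracket C A :> 'M[R]_N.
Proof. by rewrite /bracket mulrN mulNr opprB addrC opprK. Qed.

Lemma bracketZ C k A : bracket C (k *: A) = k *: bracket C A :> 'M[R]_N.
Proof.
have -> : bracket C (k *: A) = C *m (k *: A) - (k *: A) *m C by [].
by rewrite -scalemxAr -scalemxAl -scalerBr.
Qed.

Lemma bracket_sum C (S : Type) (r : seq S) (P : pred S) (F : S -> 'M[R]_N) :
  bracket C (\sum_(i <- r | P i) F i) = \sum_(i <- r | P i) bracket C (F i).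
Proof. by rewrite /bracket mulr_sumr mulr_suml -sumrB. Qed.

Lemma smooth_bracket T (X : 'rV[R]_n -> 'M[R]_N) :
  smooth_mx_on U X -> smooth_tensor U T ->
  smooth_tensor U (fun I x => bracket (X x) (T I x)).
Proof.
move=> XS TS I; apply: (smooth_mxD openU (smooth_mxM openU XS (TS I))).
exact: (smooth_mxN openU (smooth_mxM openU (TS I) XS)).
Qed.

Lemma cov_bracket C T I x : smooth_tensor U T -> U x ->
  cov_mx g (fun I y => bracket C (T I y)) I x = bracket C (cov_mx g T I x).
Proof.
move=> TS Ux; case: I => [|i I].
  by rewrite !cov_mx_nil /bracket mulr0 mul0r subr0.
have CS := smooth_mx_cst openU C.
rewrite !cov_mx_cons bracketD bracketN; congr (_ - _).
  have TCS : smooth_mx_on U (fun y => T I y * C) by exact: (smooth_mxM openU (TS I) CS).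
  rewrite (partial_mxD _ (smooth_mxM openU CS (TS I)) (smooth_mxN openU TCS)) //.
  have -> : partial_mx i (fun y => - (T I y * C)) x
            = - partial_mx i (fun y => T I y * C) x.
    apply/eqP; rewrite -addr_eq0 -(partial_mxD _ (smooth_mxN openU TCS)) //.
    by under eq_fun do rewrite addNr; rewrite partial_mx_cst.
  rewrite (partial_mxM openU _ CS (TS I) Ux) (partial_mxM openU _ (TS I) CS Ux).
  by rewrite partial_mx_cst mul0r add0r mulr0 addr0.
rewrite bracket_sum; apply: eq_bigr => s _.
by rewrite bracket_sum; apply: eq_bigr => l _; rewrite bracketZ.
Qed.

Lemma nabla_bracket C a k T : smooth_tensor U T ->
  eq_tensor U k (nabla g a (fun I y => bracket C (T I y)))
    (fun I x => bracket C (nabla g a T I x)).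
Proof.
move=> TS; elim: a k => [//|a IH] [|k] I x sI Ux.
  by case: I sI => // _; rewrite !nablaS !cov_mx_nil /bracket mulr0 mul0r subr0.
rewrite nablaS (eq_cov g openU (IH k) sI Ux).
by apply: cov_bracket Ux; exact: (smooth_nabla openU metric_g).
Qed.

Lemma eq_contract k (sigma : 'S_k) T T' x : eq_tensor U k T T' -> U x ->
  Defs.contract g sigma T x = Defs.contract g sigma T' x.
Proof.
by move=> TT' Ux; apply: eq_bigr => t _; rewrite TT' ?size_tuple.
Qed.

Lemma contractD k (sigma : 'S_k) T T' x :
  Defs.contract g sigma (fun I y => T I y + T' I y) x
  = Defs.contract g sigma T x + Defs.contract g sigma T' x.
Proof. by rewrite -big_split; apply: eq_bigr => t _; rewrite scalerDr. Qed.

Lemma contractN k (sigma : 'S_k) T x :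
  Defs.contract g sigma (fun I y => - T I y) x
  = - Defs.contract g sigma T x.
Proof. by rewrite -sumrN; apply: eq_bigr => t _; rewrite scalerN. Qed.

Lemma contract_bracket k (sigma : 'S_k) C T x :
  Defs.contract g sigma (fun I y => bracket C (T I y)) x
  = bracket C (Defs.contract g sigma T x).
Proof. by rewrite bracket_sum; apply: eq_bigr => t _; rewrite bracketZ. Qed.

End Constants.

(** All the data over which the coefficients have to be uniform. *)
Record setting (R : realType) := Setting {
  dim : nat;
  size_mx : nat;
  metric : 'rV[R]_dim -> 'M[R]_dim;
  Jfun : 'rV[R]_dim -> 'M[R]_size_mx;
  lambda : 'M[R]_size_mx;
  point : 'rV[R]_dim;
  metricP : metric_on unit_ball metric;
  smooth_Jfun : smooth_mx_on unit_ball Jfun;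
  Jfun_sqr : forall x, unit_ball x -> Jfun x ^+ 2 = - 1;
  pointP : unit_ball point }.

Arguments metric {R} c _ : rename.
Arguments Jfun {R} c _ : rename.
Arguments metricP {R} c : rename.
Arguments smooth_Jfun {R} c : rename.
Arguments Jfun_sqr {R} c [x] _ : rename.
Arguments pointP {R} c : rename.

Section Families.
Context {R : realType}.
Local Notation setting := (setting R).

Definition family := forall c : setting, @tensor R (dim c) 'M[R]_(size_mx c).
Implicit Types (V W X : family) (c : setting).

Definition smoothf V := forall c, smooth_tensor unit_ball (V c).
Definition eqf k V W := forall c, eq_tensor unit_ball k (V c) (W c).

Definition addf V W : family := fun c I x => V c I x + W c I x.
Definition oppf V : family := fun c I x => - V c I x.
Definition mulf b V W : family := fun c => tensor_mul b (V c) (W c).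
Definition nablaf a V : family := fun c => nabla (metric c) a (V c).
Definition rearr (rho : forall S : Type, seq S -> seq S) V : family :=
  fun c I x => V c (rho _ I) x.
Definition bracketf (X : forall c, 'rV[R]_(dim c) -> 'M[R]_(size_mx c)) V :
  family := fun c I x => bracket (X c x) (V c I x).

Definition Pfun c x := Jfun c x - lambda c.
Definition Jf : family := fun c _ => Jfun c.
Definition Pf : family := fun c _ => Pfun (c := c).
Definition DJ b := nablaf b Jf.
Definition DP b := nablaf b Pf.

Lemma eqf_refl k V : eqf k V V. Proof. by []. Qed.
Lemma eqf_sym k V W : eqf k V W -> eqf k W V.
Proof. by move=> VW c I x sI Ux; rewrite VW. Qed.
Lemma eqf_trans k W V X : eqf k V W -> eqf k W X -> eqf k V X.
Proof. by move=> VW WX c I x sI Ux; rewrite VW ?WX. Qed.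

Lemma eqf_nabla a k V W : eqf k V W -> eqf (a + k) (nablaf a V) (nablaf a W).
Proof. by move=> VW c; apply: eq_nabla => //; exact: open_unit_ball. Qed.

Lemma eqf_mul b k V V' W W' :
  eqf b V V' -> eqf k W W' -> eqf (b + k) (mulf b V W) (mulf b V' W').
Proof.
move=> VV' WW' c I x sI Ux; rewrite /mulf /tensor_mul VV' ?WW' //.
  by rewrite size_drop sI addKn.
by rewrite size_takel // sI leq_addr.
Qed.

Lemma smooth_addf V W : smoothf V -> smoothf W -> smoothf (addf V W).
Proof. by move=> VS WS c I; apply: (smooth_mxD open_unit_ball); [exact: VS|exact: WS]. Qed.

Lemma smooth_oppf V : smoothf V -> smoothf (oppf V).
Proof. by move=> VS c I; apply: (smooth_mxN open_unit_ball); exact: VS. Qed.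

Lemma smooth_mulf b V W : smoothf V -> smoothf W -> smoothf (mulf b V W).
Proof.
by move=> VS WS c; apply: (smooth_tensor_mul open_unit_ball); [exact: VS|exact: WS].
Qed.

Lemma smooth_nablaf a V : smoothf V -> smoothf (nablaf a V).
Proof.
by move=> VS c; apply: (smooth_nabla open_unit_ball (metricP c)); exact: VS.
Qed.

Lemma smooth_rearr rho V : smoothf V -> smoothf (rearr rho V).
Proof. by move=> VS c I; exact: VS. Qed.

Lemma smooth_Jf : smoothf Jf.
Proof. by move=> c I; exact: smooth_Jfun. Qed.

Lemma smooth_Pf : smoothf Pf.
Proof.
move=> c I; apply: (smooth_mxD open_unit_ball); first exact: smooth_Jfun.
exact: (smooth_mx_cst open_unit_ball (- lambda c)).
Qed.

Lemma smooth_DJ b : smoothf (DJ b).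
Proof. exact/smooth_nablaf/smooth_Jf. Qed.

Lemma smooth_DP b : smoothf (DP b).
Proof. exact/smooth_nablaf/smooth_Pf. Qed.

(** lambda0 is constant. *)
Lemma DP_DJ b : (0 < b)%N -> eqf b (DP b) (DJ b).
Proof.
case: b => // b _; elim: b => [|b IH]; last exact: (@eqf_nabla 1 b.+1 _ _ IH).
move=> c [//|i [|//]] x _ Ux; rewrite /DP /DJ /nablaf !nablaS !cov_mx_cons.
rewrite !big_nil; congr (_ - _).
rewrite (partial_mxD _ (smooth_Jf (c := c) [::])
  (smooth_mx_cst open_unit_ball (- lambda c))) //.
by rewrite partial_mx_cst addr0.
Qed.

Lemma nablafSr a V : nablaf a.+1 V = nablaf a (nablaf 1 V).
Proof.
by apply: functional_extensionality_dep => c; rewrite /nablaf /nabla iterSr.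
Qed.

Lemma nablafD a k V W : smoothf V -> smoothf W ->
  eqf k (nablaf a (addf V W)) (addf (nablaf a V) (nablaf a W)).
Proof.
by move=> VS WS c; apply: (nablaD open_unit_ball (metricP c)); [exact: VS|exact: WS].
Qed.

Lemma nablafN a k V : smoothf V ->
  eqf k (nablaf a (oppf V)) (oppf (nablaf a V)).
Proof. by move=> VS c; apply: (nablaN open_unit_ball (metricP c)); exact: VS. Qed.

Lemma nablaf_rearr a rho V : rearrangement rho ->
  nablaf a (rearr rho V) = rearr (shift a rho) (nablaf a V).
Proof.
move=> rho_re; apply: functional_extensionality_dep => c.
exact: (nabla_rearrangement _ _ _ rho_re).
Qed.

(** Leibniz rule; in the second term the derivative index has to move past the
    indices of the first factor. *)
Lemma nabla1_mul b k V W : smoothf V -> smoothf W ->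
  eqf (b + k).+1 (nablaf 1 (mulf b V W))
    (addf (mulf b.+1 (nablaf 1 V) W) (rearr (move_head b) (mulf b V (nablaf 1 W)))).
Proof.
move=> VS WS c [//|i I] x [sI] Ux.
have sI1 : size (take b I) = b by rewrite size_takel // sI leq_addr.
rewrite -[I](cat_take_drop b) /nablaf /mulf /addf /rearr nablaS.
rewrite (cov_tensor_mul (metric c) open_unit_ball _ _ (VS c) (WS c) Ux sI1); congr (_ + _).
  by rewrite -cat_cons tensor_mulE //= sI1.
rewrite /move_head take_cat drop_cat sI1 ltnn subnn take0 drop0 cats0.
by rewrite tensor_mulE.
Qed.

End Families.

(** * Expressible tensors and integration by parts *)

Section Spans.
Context {R : realType}.
Local Notation setting := (setting R).
Local Notation family := (@family R).
Implicit Types (V W X : family).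
Variable m : nat.

Definition spanned (F : forall c : setting, 'M[R]_(size_mx c)) :=
  exists (k : nat) (coef : 'I_k -> R) (t : 'I_k -> term),
    (forall i, admissible m (t i)) /\
    forall c : setting, F c =
      \sum_(i < k) coef i *:
        eval_term (metric c) (Jfun c) (lambda c) (t i) (point c).

Lemma eq_spanned F F' : (forall c, F c = F' c) -> spanned F -> spanned F'.
Proof.
move=> FF' [k [coef [t [adm FE]]]]; exists k, coef, t.
by split=> // c; rewrite -FF'.
Qed.

Lemma spanned0 : spanned (fun=> 0).
Proof.
exists 0%N, (fun=> 0), (fun=> @Cubic 0 0 0 1%g 1%g).
by split=> [[]//|c]; rewrite big_ord0.
Qed.

Lemma spannedD F F' :
  spanned F -> spanned F' -> spanned (fun c => F c + F' c).
Proof.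
move=> [k [coef [t [adm FE]]]] [k' [coef' [t' [adm' FE']]]].
exists (k + k')%N,
  (fun i => match fintype.split i with inl j => coef j | inr j => coef' j end),
  (fun i => match fintype.split i with inl j => t j | inr j => t' j end).
split=> [i|c]; first by case: (fintype.split i).
rewrite big_split_ord FE FE'; congr (_ + _); apply: eq_bigr => i _.
  by have -> : fintype.split (lshift k' i) = inl i := unsplitK (inl i).
by have -> : fintype.split (rshift k i) = inr i := unsplitK (inr i).
Qed.

Lemma spannedZ (a : R) F : spanned F -> spanned (fun c => a *: F c).
Proof.
move=> [k [coef [t [adm FE]]]]; exists k, (fun i => a * coef i), t.
split=> // c; rewrite FE scaler_sumr; apply: eq_bigr => i _.
by rewrite scalerA.
Qed.

Lemma spannedN F : spanned F -> spanned (fun c => - F c).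
Proof.
by move=> /(spannedZ (-1)); apply: eq_spanned => c; rewrite scaleN1r.
Qed.

Definition contractf k (sigma : 'S_k) V (c : setting) :=
  Defs.contract (metric c) sigma (V c) (point c).

(** All pairings are allowed, which makes the notion stable under rearrangements
    of the indices. The rank is a variable k with k = 2m, because the sums of
    orders that occur are equal to 2m without being convertible to it. *)
Definition expressible V := forall k (sigma : 'S_k), k = (2 * m)%N ->
  is_pairing sigma -> spanned (contractf sigma V).

Lemma expressible_eq V W : eqf (2 * m) V W -> expressible V -> expressible W.
Proof.
move=> VW Vg k sigma km pair; apply: eq_spanned (Vg k sigma km pair) => c.
by apply: (eq_contract _ _ _ (pointP c)); rewrite km.
Qed.

Lemma expressibleD V W : expressible V -> expressible W -> expressible (addf V W).
Proof.
move=> Vg Wg k sigma km pair.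
apply: eq_spanned (spannedD (Vg k sigma km pair) (Wg k sigma km pair)) => c.
by rewrite /contractf contractD.
Qed.

Lemma expressibleN V : expressible V -> expressible (oppf V).
Proof.
move=> Vg k sigma km pair; apply: eq_spanned (spannedN (Vg k sigma km pair)) => c.
by rewrite /contractf contractN.
Qed.

Lemma expressible0 : expressible (fun _ _ _ => 0).
Proof.
move=> k sigma _ _; apply: eq_spanned spanned0 => c.
by rewrite /contractf /Defs.contract big1 // => t _; rewrite scaler0.
Qed.

(** A rearrangement permutes the contractions of a tensor among themselves. *)
Lemma expressible_rearr rho V : rearrangement rho ->
  expressible (rearr rho V) <-> expressible V.
Proof.
move=> rho_re; split=> Vg k sigma km pair; have [tau tauE] := rearrangement_perm k rho_re.
  have pair' := is_pairing_conj tau^-1%g pair.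
  apply: eq_spanned (Vg k _ km pair') => c.
  rewrite /contractf.
  rewrite (@contract_tuple _ _ _ _ _ (metricP c) _ _ tau (V c) (@rearr _ rho V c)) //.
  - by rewrite invgK !mulgA mulgV mul1g mulgK.
  - exact: pointP.
  - by move=> t; rewrite /rearr tauE.
have pair' := is_pairing_conj tau pair.
apply: eq_spanned (Vg k _ km pair') => c.
rewrite /contractf.
rewrite (@contract_tuple _ _ _ _ _ (metricP c) _ _ tau (V c) (@rearr _ rho V c)) //.
- exact: pointP.
- by move=> t; rewrite /rearr tauE.
Qed.

Lemma expressible_nabla_eq a k V W : (a + k = 2 * m)%N -> eqf k V W ->
  expressible (nablaf a V) -> expressible (nablaf a W).
Proof. by move=> km VW; apply: expressible_eq; rewrite -km; exact: eqf_nabla. Qed.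

Lemma expressible_nablaD a V W : smoothf V -> smoothf W ->
  expressible (nablaf a V) -> expressible (nablaf a W) ->
  expressible (nablaf a (addf V W)).
Proof.
move=> VS WS Vg Wg; apply: expressible_eq (expressibleD Vg Wg).
exact/eqf_sym/nablafD.
Qed.

Lemma expressible_nablaN a V : smoothf V -> expressible (nablaf a V) ->
  expressible (nablaf a (oppf V)).
Proof.
move=> VS Vg; apply: expressible_eq (expressibleN Vg).
exact/eqf_sym/nablafN.
Qed.

Lemma expressible_nabla_rearr a rho V : rearrangement rho ->
  expressible (nablaf a (rearr rho V)) <-> expressible (nablaf a V).
Proof.
move=> rho_re; rewrite nablaf_rearr //; apply: expressible_rearr.
exact: rearrangement_shift.
Qed.

Definition cubic b V b' V' W := mulf b V (mulf b' V' W).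

Lemma star_perm3 (N : nat) (s : 'S_3) (A : 3.-tuple 'M[R]_N) :
  star s A = tnth A (s ord0) * (tnth A (s (inord 1)) * tnth A (s (inord 2))).
Proof.
rewrite /star !big_ord_recl big_ord0 mulr1.
by congr (_ * (tnth A (s _) * tnth A (s _))); apply: val_inj; rewrite /= inordK.
Qed.

(** The tensor that a cubic term differentiates and contracts. *)
Definition starf (s : 'S_3) b c : family := fun st I x =>
  star s [tuple Pfun x; @DJ _ b st (take b I) x; @DJ _ c st (drop b I) x].

Lemma expressible_starf s a b c : (0 < a)%N -> (b <= m)%N -> (c <= m)%N ->
  (0 < b + c)%N -> (a + b + c = 2 * m)%N -> expressible (nablaf a (starf s b c)).
Proof.
move=> a0 bm cm bc abc k sigma; rewrite -abc => km; subst k => pair.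
exists 1%N, (fun=> 1), (fun=> @Cubic a b c s sigma).
split=> [_|st]; first by split=> //; lia.
by rewrite big_ord1 scale1r.
Qed.

Lemma expressible_P1 a b c : (0 < a)%N -> (b <= m)%N -> (c <= m)%N ->
  (0 < b + c)%N -> (a + b + c = 2 * m)%N ->
  expressible (nablaf a (cubic 0 Pf b (DJ b) (DJ c))).
Proof.
move=> a0 bm cm bc abc.
apply: (@expressible_nabla_eq _ (b + c) (starf 1%g b c)); first by lia.
  move=> st I x sI Ux; rewrite /starf star_perm3 !perm1 !(tnth_nth 0) /= !inordK //=.
  by rewrite /cubic /mulf /tensor_mul drop0.
exact: expressible_starf.
Qed.

Lemma expressible_P2 a b c : (0 < a)%N -> (b <= m)%N -> (c <= m)%N ->
  (0 < b + c)%N -> (a + b + c = 2 * m)%N ->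
  expressible (nablaf a (cubic b (DJ b) 0 Pf (DJ c))).
Proof.
move=> a0 bm cm bc abc.
pose s : 'S_3 := tperm ord0 (inord 1).
apply: (@expressible_nabla_eq _ (b + c) (starf s b c)); first by lia.
  move=> st I x sI Ux; rewrite /starf star_perm3 /s tpermL tpermR tpermD.
  - rewrite !(tnth_nth 0) /= !inordK //=.
    by rewrite /cubic /mulf /tensor_mul drop0.
  - by apply/eqP => /(congr1 val); rewrite /= inordK.
  - by apply/eqP => /(congr1 val); rewrite /= !inordK.
exact: expressible_starf.
Qed.

Lemma expressible_P3 a b c : (0 < a)%N -> (b <= m)%N -> (c <= m)%N ->
  (0 < b + c)%N -> (a + b + c = 2 * m)%N ->
  expressible (nablaf a (cubic b (DJ b) c (DJ c) Pf)).
Proof.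
move=> a0 bm cm bc abc.
pose s : 'S_3 := perm (can_inj (@ordSK 3)).
apply: (@expressible_nabla_eq _ (b + c) (starf s b c)); first by lia.
  move=> st I x sI Ux; rewrite /starf star_perm3 /s !permE.
  rewrite !(tnth_nth 0) /= !inordK //= /cubic /mulf /tensor_mul.
  by rewrite (@take_oversize _ c (drop b I)) // size_drop sI addKn.
exact: expressible_starf.
Qed.

(** Derivatives of P rather than of J: a factor of order 0 is then the P of an
    admissible term, and factors of positive order are the same for both. *)
Definition cubic_expressible a b1 b2 b3 :=
  expressible (nablaf a (cubic b1 (DP b1) b2 (DP b2) (DP b3))).

Lemma eqf_cubic b1 b2 b3 V1 V1' V2 V2' V3 V3' :
  eqf b1 V1 V1' -> eqf b2 V2 V2' -> eqf b3 V3 V3' ->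
  eqf (b1 + (b2 + b3)) (cubic b1 V1 b2 V2 V3) (cubic b1 V1' b2 V2' V3').
Proof. by move=> e1 e2 e3; apply: eqf_mul => //; exact: eqf_mul. Qed.

Lemma cubic_expressible_P1 a b c : (0 < a)%N -> (0 < b <= m)%N -> (0 < c <= m)%N ->
  (a + b + c = 2 * m)%N -> cubic_expressible a 0 b c.
Proof.
move=> a0 /andP[b0 bm] /andP[c0 cm] abc.
apply: (@expressible_nabla_eq _ (0 + (b + c)) (cubic 0 Pf b (DJ b) (DJ c))); first by lia.
  by apply: eqf_cubic => //; apply/eqf_sym/DP_DJ.
by apply: expressible_P1 => //; lia.
Qed.

Lemma cubic_expressible_P2 a b c : (0 < a)%N -> (0 < b <= m)%N -> (0 < c <= m)%N ->
  (a + b + c = 2 * m)%N -> cubic_expressible a b 0 c.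
Proof.
move=> a0 /andP[b0 bm] /andP[c0 cm] abc.
apply: (@expressible_nabla_eq _ (b + (0 + c)) (cubic b (DJ b) 0 Pf (DJ c))); first by lia.
  by apply: eqf_cubic => //; apply/eqf_sym/DP_DJ.
by apply: expressible_P2 => //; lia.
Qed.

Lemma cubic_expressible_P3 a b c : (0 < a)%N -> (0 < b <= m)%N -> (0 < c <= m)%N ->
  (a + b + c = 2 * m)%N -> cubic_expressible a b c 0.
Proof.
move=> a0 /andP[b0 bm] /andP[c0 cm] abc.
apply: (@expressible_nabla_eq _ (b + (c + 0)) (cubic b (DJ b) c (DJ c) Pf)); first by lia.
  by apply: eqf_cubic => //; apply/eqf_sym/DP_DJ.
by apply: expressible_P3 => //; lia.
Qed.

Lemma nabla1_cubic b1 b2 b3 V1 V2 V3 :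
  smoothf V1 -> smoothf V2 -> smoothf V3 ->
  eqf (b1 + (b2 + b3)).+1 (nablaf 1 (cubic b1 V1 b2 V2 V3))
    (addf (cubic b1.+1 (nablaf 1 V1) b2 V2 V3)
      (addf (rearr (move_head b1) (cubic b1 V1 b2.+1 (nablaf 1 V2) V3))
            (rearr (move_head (b1 + b2)) (cubic b1 V1 b2 V2 (nablaf 1 V3))))).
Proof.
move=> S1 S2 S3.
have S23 : smoothf (mulf b2 V2 V3) by exact: smooth_mulf.
apply: eqf_trans (@nabla1_mul _ b1 (b2 + b3) _ _ S1 S23) _.
move=> c [//|i I] x [sI] Ux; rewrite /addf; congr (_ + _).
have sI1 : size (take b1 I) = b1 by rewrite size_takel // sI leq_addr.
rewrite -[I](cat_take_drop b1); set I1 := take b1 I; set K := drop b1 I.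
have sK : size K = (b2 + b3)%N by rewrite size_drop sI addKn.
rewrite /rearr /move_head !take_cat !drop_cat sI1 ltnn subnn take0 drop0 cats0.
rewrite ltnNge leq_addr addKn /= -catA.
rewrite /cubic ![mulf b1 _ _]/mulf /= !tensor_mulE //.
rewrite -mulrDr; congr (_ * _).
by apply: (@nabla1_mul _ b2 b3 _ _ S2 S3 c (i :: K)) => //; rewrite /= sK.
Qed.

(** The form in which integration by parts is used: S is a derivative, and V and W
    are the two parts of its Leibniz rule. *)
Lemma expressible_addl a k S V W : (a + k = 2 * m)%N -> smoothf V -> smoothf W ->
  eqf k S (addf V W) -> expressible (nablaf a S) -> expressible (nablaf a W) ->
  expressible (nablaf a V).
Proof.
move=> ak VS WS SE Sg Wg.
apply: (expressible_nabla_eq (V := addf (addf V W) (oppf W)) ak).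
  by move=> c I x _ _; rewrite /addf /oppf addrK.
apply: expressible_nablaD;
  [exact: smooth_addf|exact: smooth_oppf| |exact: expressible_nablaN].
exact: expressible_nabla_eq SE Sg.
Qed.

Lemma expressible_addr a k S V W : (a + k = 2 * m)%N -> smoothf V -> smoothf W ->
  eqf k S (addf V W) -> expressible (nablaf a S) -> expressible (nablaf a V) ->
  expressible (nablaf a W).
Proof.
move=> ak VS WS SE; apply: expressible_addl ak WS VS _.
by apply: eqf_trans SE _ => c I x _ _; rewrite /addf addrC.
Qed.

Lemma smooth_cubic b1 b2 V1 V2 V3 : smoothf V1 -> smoothf V2 -> smoothf V3 ->
  smoothf (cubic b1 V1 b2 V2 V3).
Proof.
by move=> S1 S2 S3; exact: (@smooth_mulf _ b1 _ _ S1 (@smooth_mulf _ b2 _ _ S2 S3)).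
Qed.

Section ByParts.
Variables (a b1 b2 b3 : nat).
Hypotheses (rank : (a + (b1 + b2 + b3).+1 = 2 * m)%N).
Hypothesis outer : cubic_expressible a.+1 b1 b2 b3.

Let D1 := cubic b1.+1 (DP b1.+1) b2 (DP b2) (DP b3).
Let D2 := rearr (move_head b1) (cubic b1 (DP b1) b2.+1 (DP b2.+1) (DP b3)).
Let D3 := rearr (move_head (b1 + b2)) (cubic b1 (DP b1) b2 (DP b2) (DP b3.+1)).

Let D1S : smoothf D1.
Proof. by apply: smooth_cubic; exact: smooth_DP. Qed.
Let D2S : smoothf D2.
Proof. by apply/smooth_rearr/smooth_cubic; exact: smooth_DP. Qed.
Let D3S : smoothf D3.
Proof. by apply/smooth_rearr/smooth_cubic; exact: smooth_DP. Qed.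
Let D23S : smoothf (addf D2 D3). Proof. exact: smooth_addf. Qed.

Let outer' : expressible (nablaf a (nablaf 1 (cubic b1 (DP b1) b2 (DP b2) (DP b3)))).
Proof. by rewrite -nablafSr. Qed.

Let leibniz : eqf (b1 + (b2 + b3)).+1
  (nablaf 1 (cubic b1 (DP b1) b2 (DP b2) (DP b3))) (addf D1 (addf D2 D3)).
Proof. by apply: nabla1_cubic; exact: smooth_DP. Qed.

Let rank' : (a + (b1 + (b2 + b3)).+1 = 2 * m)%N. Proof. by rewrite addnA. Qed.

Lemma cubic_expressible_by_parts1 :
  cubic_expressible a b1 b2.+1 b3 -> cubic_expressible a b1 b2 b3.+1 ->
  cubic_expressible a b1.+1 b2 b3.
Proof.
move=> g2 g3; apply: (expressible_addl rank' D1S D23S leibniz outer').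
apply: expressible_nablaD => //; apply/expressible_nabla_rearr => //;
  exact: rearrangement_move_head.
Qed.

Let sum23_expressible :
  cubic_expressible a b1.+1 b2 b3 -> expressible (nablaf a (addf D2 D3)).
Proof. exact: (expressible_addr rank' D1S D23S leibniz outer'). Qed.

Lemma cubic_expressible_by_parts2 :
  cubic_expressible a b1.+1 b2 b3 -> cubic_expressible a b1 b2 b3.+1 ->
  cubic_expressible a b1 b2.+1 b3.
Proof.
move=> /sum23_expressible g23 g3.
have gD3 : expressible (nablaf a D3).
  by apply/expressible_nabla_rearr => //; exact: rearrangement_move_head.
have gD2 : expressible (nablaf a D2).
  exact: (expressible_addl rank' D2S D3S (@eqf_refl _ _ (addf D2 D3)) g23 gD3).
exact: (proj1 (expressible_nabla_rearr _ _ (rearrangement_move_head b1)) gD2).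
Qed.

Lemma cubic_expressible_by_parts3 :
  cubic_expressible a b1.+1 b2 b3 -> cubic_expressible a b1 b2.+1 b3 ->
  cubic_expressible a b1 b2 b3.+1.
Proof.
move=> /sum23_expressible g23 g2.
have gD2 : expressible (nablaf a D2).
  by apply/expressible_nabla_rearr => //; exact: rearrangement_move_head.
have gD3 : expressible (nablaf a D3).
  exact: (expressible_addr rank' D2S D3S (@eqf_refl _ _ (addf D2 D3)) g23 gD2).
exact: (proj1 (expressible_nabla_rearr _ _ (rearrangement_move_head (b1 + b2))) gD3).
Qed.

End ByParts.

(** Removing the only derivative of one factor makes this factor P and raises the
    order of one of the others by one, hence the strict bounds. *)
Lemma cubic_expressible_first a b c : (0 < a)%N -> (0 < b < m)%N -> (0 < c < m)%N ->
  (a + 1 + b + c = 2 * m)%N -> cubic_expressible a 1 b c.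
Proof.
move=> a0 b0 c0 abc; apply: cubic_expressible_by_parts1; first by lia.
- by apply: cubic_expressible_P1; lia.
- by apply: cubic_expressible_P1; lia.
- by apply: cubic_expressible_P1; lia.
Qed.

Lemma cubic_expressible_second a b c : (0 < a)%N -> (0 < b < m)%N -> (0 < c < m)%N ->
  (a + 1 + b + c = 2 * m)%N -> cubic_expressible a b 1 c.
Proof.
move=> a0 b0 c0 abc; apply: cubic_expressible_by_parts2; first by lia.
- by apply: cubic_expressible_P2; lia.
- by apply: cubic_expressible_P2; lia.
- by apply: cubic_expressible_P2; lia.
Qed.

Lemma cubic_expressible_third a b c : (0 < a)%N -> (0 < b < m)%N -> (0 < c < m)%N ->
  (a + 1 + b + c = 2 * m)%N -> cubic_expressible a b c 1.
Proof.
move=> a0 b0 c0 abc; apply: cubic_expressible_by_parts3; first by lia.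
- by apply: cubic_expressible_P3; lia.
- by apply: cubic_expressible_P3; lia.
- by apply: cubic_expressible_P3; lia.
Qed.

Hypothesis m_le3 : (m <= 3)%N.

(** For m <= 3 the orders cannot all be 2, because a > 0 leaves at most 2m - 1 <= 5
    derivatives inside. *)
Lemma cubic_expressible_le2 a b1 b2 b3 : (0 < a)%N ->
  (0 < b1 <= 2)%N -> (0 < b2 <= 2)%N -> (0 < b3 <= 2)%N ->
  (a + b1 + b2 + b3 = 2 * m)%N -> cubic_expressible a b1 b2 b3.
Proof.
move=> a0 b1r b2r b3r rk.
have [b1E|b1N] := eqVneq b1 1%N; first by subst b1; apply: cubic_expressible_first; lia.
have [b2E|b2N] := eqVneq b2 1%N; first by subst b2; apply: cubic_expressible_second; lia.
have [b3E|b3N] := eqVneq b3 1%N; first by subst b3; apply: cubic_expressible_third; lia.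
by exfalso; lia.
Qed.

(** An order of 3 forces m = 3, a = 1 and the two other orders to be 1; lowering it
    by one derivative leads to orders at most 2. *)
Lemma cubic_expressible_pos a b1 b2 b3 : (0 < a)%N ->
  (0 < b1)%N -> (0 < b2)%N -> (0 < b3)%N ->
  (a + b1 + b2 + b3 = 2 * m)%N -> cubic_expressible a b1 b2 b3.
Proof.
move=> a0 b10 b20 b30 rk.
have [b1r|b1r] := leqP b1 2; last first.
  have [-> -> ->] : [/\ b1 = 3, b2 = 1 & b3 = 1]%N by split; lia.
  by apply: cubic_expressible_by_parts1; [lia|apply: cubic_expressible_le2; lia..].
have [b2r|b2r] := leqP b2 2; last first.
  have [-> -> ->] : [/\ b1 = 1, b2 = 3 & b3 = 1]%N by split; lia.
  by apply: cubic_expressible_by_parts2; [lia|apply: cubic_expressible_le2; lia..].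
have [b3r|b3r] := leqP b3 2; last first.
  have [-> -> ->] : [/\ b1 = 1, b2 = 1 & b3 = 3]%N by split; lia.
  by apply: cubic_expressible_by_parts3; [lia|apply: cubic_expressible_le2; lia..].
by apply: cubic_expressible_le2; lia.
Qed.

Lemma expressible_cubic a b1 b2 b3 : (0 < a)%N ->
  (0 < b1)%N -> (0 < b2)%N -> (0 < b3)%N ->
  (a + b1 + b2 + b3 = 2 * m)%N ->
  expressible (nablaf a (cubic b1 (DJ b1) b2 (DJ b2) (DJ b3))).
Proof.
move=> a0 b10 b20 b30 rk.
apply: (expressible_nabla_eq _ _ (cubic_expressible_pos a0 b10 b20 b30 rk)); first last.
  by apply: eqf_cubic; exact: DP_DJ.
by rewrite -rk !addnA.
Qed.

End Spans.

(** * Anticommutators of J with its derivatives *)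

Section Cancellation.
Context {R : realType}.
Local Notation family := (@family R).
Implicit Types (V W X : family).
Variable m : nat.
Local Notation expressible := (@expressible R m).
Hypothesis m_le3 : (m <= 3)%N.
Local Notation J := (@Jf R).
Local Notation D := (@DJ R).
Local Notation P := (@Pf R).

Definition anticomm b : family := addf (mulf 0 J (D b)) (mulf b (D b) J).

Lemma smooth_anticomm b : smoothf (anticomm b).
Proof.
have JS := @smooth_Jf R; have DS := @smooth_DJ R b.
exact: (smooth_addf (@smooth_mulf _ 0 _ _ JS DS) (@smooth_mulf _ b _ _ DS JS)).
Qed.

Lemma anticommE b (c : setting R) I x : size I = b ->
  anticomm b I x = Jfun c x * D b I x + D b I x * Jfun c x.
Proof.
by move=> sI; rewrite /anticomm /addf /mulf /tensor_mul drop0 (@take_oversize _ b) ?sI.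
Qed.

Lemma nabla1_J : nablaf 1 J = D 1. Proof. by []. Qed.
Lemma nabla1_D b : nablaf 1 (D b) = D b.+1. Proof. by []. Qed.

(** The derivative of the constant J^2. *)
Lemma anticomm1 : eqf 1 (anticomm 1) (fun _ _ _ => 0).
Proof.
have JJ : eqf 0 (mulf 0 J J) (fun _ _ _ => -1).
  by move=> c I x /size0nil -> Ux; rewrite /mulf /tensor_mul -expr2 Jfun_sqr.
apply: (@eqf_trans _ 1 (nablaf 1 (mulf 0 J J))) => [c I x sI Ux|].
  rewrite (@nabla1_mul _ 0 0 _ _ (@smooth_Jf R) (@smooth_Jf R) c I x sI Ux).
  rewrite /anticomm /addf addrC; case: I sI => [//|i [|//]] _.
  by rewrite /rearr /mulf /tensor_mul.
apply: eqf_trans (@eqf_nabla _ 1 0 _ _ JJ) _.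
move=> c [//|i [|//]] x _ _.
by rewrite /nablaf nablaS cov_mx_cons partial_mx_cst big_nil subr0.
Qed.

Lemma nabla1_anticomm b : eqf b.+1 (nablaf 1 (anticomm b))
  (addf (anticomm b.+1)
    (addf (mulf 1 (D 1) (D b)) (rearr (move_head b) (mulf b (D b) (D 1))))).
Proof.
have JS := @smooth_Jf R; have DS := @smooth_DJ R.
have S1 := @smooth_mulf _ 0 _ _ JS (DS b); have S2 := @smooth_mulf _ b _ _ (DS b) JS.
apply: eqf_trans (@nablafD _ 1 _ _ _ S1 S2) _.
move=> c I x sI Ux; rewrite {1}/addf.
rewrite (@nabla1_mul _ 0 b _ _ JS (DS b) c I x sI Ux).
have sI0 : size I = (b + 0).+1 by rewrite addn0.
rewrite (@nabla1_mul _ b 0 _ _ (DS b) JS c I x sI0 Ux).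
rewrite /anticomm /addf !nabla1_J !nabla1_D.
case: I sI sI0 => [//|i I] sI sI0; rewrite {1}/rearr /move_head take0 drop0 cat0s.
by rewrite [X in X + _ = _]addrC addrACA.
Qed.

Lemma mulfE b V W (c : setting R) I1 I2 x : size I1 = b ->
  mulf b V W (I1 ++ I2) x = V c I1 x * W c I2 x.
Proof. exact: tensor_mulE. Qed.

Lemma move_headE (S : Type) b (i : S) I1 I2 : size I1 = b ->
  move_head b (i :: I1 ++ I2) = I1 ++ i :: I2.
Proof. by move=> sI1; rewrite /move_head take_size_cat // drop_size_cat. Qed.

Lemma nabla1_anticomm_mul b c :
  eqf (b.+1 + c) (mulf b.+1 (nablaf 1 (anticomm b)) (D c))
    (addf (mulf b.+1 (anticomm b.+1) (D c))
      (addf (cubic 1 (D 1) b (D b) (D c))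
            (rearr (move_head b) (cubic b (D b) 1 (D 1) (D c))))).
Proof.
move=> s [//|i I] x [sI] Ux.
have sI1 : size (take b I) = b by rewrite size_takel // sI leq_addr.
rewrite -[I](cat_take_drop b); move: (take b I) (drop b I) sI1 => I1 I2 sI1.
have sI1' : size (i :: I1) = b.+1 by rewrite /= sI1.
rewrite /addf /rearr move_headE // -cat_cons !mulfE //.
rewrite (@nabla1_anticomm b s (i :: I1) x sI1' Ux) /addf !mulrDl; congr (_ + (_ + _)).
  by rewrite /cubic cat_cons -(cat1s i (I1 ++ I2)) -(cat1s i I1) !mulfE // mulrA.
rewrite /rearr -{1}(cats0 I1) move_headE // /cubic -(cat1s i I2) !mulfE //.
by rewrite mulrA.
Qed.

Lemma nabla1_mul_anticomm b c :
  eqf (c + b.+1) (mulf c (D c) (nablaf 1 (anticomm b)))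
    (addf (mulf c (D c) (anticomm b.+1))
      (addf (cubic c (D c) 1 (D 1) (D b))
            (rearr (shift c (move_head b)) (cubic c (D c) b (D b) (D 1))))).
Proof.
move=> s I x sI Ux.
have sI1 : size (take c I) = c by rewrite size_takel // sI leq_addr.
have sI2 : size (drop c I) = b.+1 by rewrite size_drop sI addKn.
rewrite -[I](cat_take_drop c); move: (take c I) (drop c I) sI1 sI2 => I1 I2 sI1 sI2.
rewrite /addf /rearr /shift take_size_cat // drop_size_cat // /cubic !mulfE //.
rewrite (@nabla1_anticomm b s I2 x) // /addf !mulrDr; congr (_ + (_ + _)).
Qed.

(** Solve the Leibniz rule [nabla1_anticomm_mul] for the anticommutator of order
    b + 1, and integrate by parts the derivative of the one of order b. *)
Lemma expressible_anticomm_mul a b c : (0 < a)%N -> (0 < b)%N -> (0 < c)%N ->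
  (a + b + c = 2 * m)%N -> expressible (nablaf a (mulf b (anticomm b) (D c))).
Proof.
have DS := @smooth_DJ R.
elim: b a c => [//|[_|b IH]] a c a0 _ c0 rk.
  apply: (@expressible_nabla_eq _ m a (1 + c) (fun _ _ _ => 0)); first by lia.
    apply: eqf_sym => s I x sI Ux; rewrite /mulf /tensor_mul anticomm1 ?mul0r //.
    by rewrite size_takel // sI leq_addr.
  apply: expressible_eq (@expressible0 R m).
  by apply: eqf_sym => s; apply: (nabla0 (metric s) open_unit_ball).
have AS := smooth_anticomm b.+1.
have g1 : expressible (nablaf a (mulf b.+2 (nablaf 1 (anticomm b.+1)) (D c))).
  apply: (@expressible_addl _ m a (b.+1 + c).+1 _ _
    (rearr (move_head b.+1) (mulf b.+1 (anticomm b.+1) (D c.+1))) _ _ _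
    (@nabla1_mul _ b.+1 c _ _ AS (DS c))).
  - by lia.
  - exact: (@smooth_mulf _ b.+2 _ _ (smooth_nablaf 1 AS) (DS c)).
  - exact: (smooth_rearr _ (@smooth_mulf _ b.+1 _ _ AS (DS c.+1))).
  - by rewrite -nablafSr; apply: IH; lia.
  - by apply/(expressible_nabla_rearr m a _ (rearrangement_move_head b.+1)); apply: IH; lia.
have CS1 := @smooth_cubic R 1 b.+1 _ _ _ (DS 1%N) (DS b.+1) (DS c).
have CS2 := @smooth_rearr R (move_head b.+1) _
  (@smooth_cubic R b.+1 1 _ _ _ (DS b.+1) (DS 1%N) (DS c)).
apply: (@expressible_addl _ m a (b.+2 + c) _ _ _ _ _ (smooth_addf CS1 CS2)
  (@nabla1_anticomm_mul b.+1 c) g1).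
- by lia.
- exact: (@smooth_mulf _ b.+2 _ _ (smooth_anticomm b.+2) (DS c)).
apply: (expressible_nablaD CS1 CS2); first by apply: expressible_cubic; lia.
apply/(expressible_nabla_rearr m a _ (rearrangement_move_head b.+1)).
by apply: expressible_cubic; lia.
Qed.

Lemma expressible_mul_anticomm a b c : (0 < a)%N -> (0 < b)%N -> (0 < c)%N ->
  (a + b + c = 2 * m)%N -> expressible (nablaf a (mulf c (D c) (anticomm b))).
Proof.
have DS := @smooth_DJ R.
elim: b a c => [//|[_|b IH]] a c a0 _ c0 rk.
  apply: (@expressible_nabla_eq _ m a (c + 1) (fun _ _ _ => 0)); first by lia.
    apply: eqf_sym => s I x sI Ux; rewrite /mulf /tensor_mul anticomm1 ?mulr0 //.
    by rewrite size_drop sI addKn.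
  apply: expressible_eq (@expressible0 R m).
  by apply: eqf_sym => s; apply: (nabla0 (metric s) open_unit_ball).
have AS := smooth_anticomm b.+1.
have g1 : expressible (nablaf a (mulf c (D c) (nablaf 1 (anticomm b.+1)))).
  apply/(expressible_nabla_rearr m a _ (rearrangement_move_head c)).
  apply: (@expressible_addr _ m a (c + b.+1).+1 _ (mulf c.+1 (D c.+1) (anticomm b.+1)) _ _ _ _
    (@nabla1_mul _ c b.+1 _ _ (DS c) AS)).
  - by lia.
  - exact: (@smooth_mulf _ c.+1 _ _ (DS c.+1) AS).
  - exact: (smooth_rearr _ (@smooth_mulf _ c _ _ (DS c) (smooth_nablaf 1 AS))).
  - by rewrite -nablafSr; apply: IH; lia.
  - by apply: IH; lia.
have CS1 := @smooth_cubic R c 1 _ _ _ (DS c) (DS 1%N) (DS b.+1).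
have CS2 := @smooth_rearr R (shift c (move_head b.+1)) _
  (@smooth_cubic R c b.+1 _ _ _ (DS c) (DS b.+1) (DS 1%N)).
apply: (@expressible_addl _ m a (c + b.+2) _ _ _ _ _ (smooth_addf CS1 CS2)
  (@nabla1_mul_anticomm b.+1 c) g1).
- by lia.
- exact: (@smooth_mulf _ c _ _ (DS c) (smooth_anticomm b.+2)).
apply: (expressible_nablaD CS1 CS2); first by apply: expressible_cubic; lia.
apply/(expressible_nabla_rearr m a _ (rearrangement_shift c (rearrangement_move_head b.+1))).
by apply: expressible_cubic; lia.
Qed.

End Cancellation.

(** * Brackets with lambda0 *)

Section Brackets.
Context {R : realType}.
Local Notation family := (@family R).
Implicit Types (V W X : family).
Variable m : nat.
Local Notation expressible := (@expressible R m).
Hypothesis m_le3 : (m <= 3)%N.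
Local Notation J := (@Jf R).
Local Notation D := (@DJ R).
Local Notation P := (@Pf R).

Definition lam_bracket V := bracketf (fun (c : setting R) _ => lambda c) V.
Definition quadratic b c : family := mulf b (D b) (D c).

Lemma smooth_bracketf (X : forall c : setting R, 'rV[R]_(dim c) -> 'M[R]_(size_mx c)) V :
  (forall c, smooth_mx_on unit_ball (X c)) -> smoothf V -> smoothf (bracketf X V).
Proof. by move=> XS VS c; exact: (smooth_bracket open_unit_ball (XS c) (VS c)). Qed.

Lemma smooth_lam_bracket V : smoothf V -> smoothf (lam_bracket V).
Proof.
move=> VS; apply: (smooth_bracketf _ VS) => c.
exact: (smooth_mx_cst open_unit_ball).
Qed.

Lemma smooth_quadratic b c : smoothf (quadratic b c).
Proof. exact: (@smooth_mulf _ b _ _ (@smooth_DJ R b) (@smooth_DJ R c)). Qed.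

Lemma nabla_lam_bracket a k V : smoothf V ->
  eqf k (nablaf a (lam_bracket V)) (lam_bracket (nablaf a V)).
Proof.
move=> VS c I x sI Ux.
exact: (nabla_bracket open_unit_ball (metricP c) (lambda c) a (VS c) sI Ux).
Qed.

Lemma eqf_lam_bracket k V W : eqf k V W -> eqf k (lam_bracket V) (lam_bracket W).
Proof. by move=> VW c I x sI Ux; rewrite /lam_bracket /bracketf (VW c I x sI Ux). Qed.

(** lambda0 = J - P. *)
Lemma lam_bracketE k V :
  eqf k (lam_bracket V) (addf (bracketf (@Jfun R) V) (oppf (bracketf (@Pfun R) V))).
Proof.
move=> c I x sI Ux; rewrite /lam_bracket /addf /oppf /bracketf /bracket /Pfun.
rewrite mulrBl mulrBr; move: (Jfun c x * _) (_ * Jfun c x) => a b.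
move: (lambda c * _) (_ * lambda c) => l r.
by rewrite opprB addrA [a - b + (b - r)]addrA subrK opprB [RHS]addrC addrA subrK.
Qed.

Lemma smooth_bracketJ V : smoothf V -> smoothf (bracketf (@Jfun R) V).
Proof. by move=> VS; apply: (smooth_bracketf _ VS) => c; exact: smooth_Jfun. Qed.

Lemma smooth_bracketP V : smoothf V -> smoothf (bracketf (@Pfun R) V).
Proof. by move=> VS; apply: (smooth_bracketf _ VS) => c; exact: (@smooth_Pf R c [::]). Qed.

Lemma expressible_lam_bracket a V : (a <= 2 * m)%N -> smoothf V ->
  expressible (nablaf a (bracketf (@Jfun R) V)) ->
  expressible (nablaf a (bracketf (@Pfun R) V)) ->
  expressible (nablaf a (lam_bracket V)).
Proof.
move=> am VS JV PV.
have PS := smooth_bracketP VS.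
apply: (@expressible_nabla_eq _ m a (2 * m - a)); first by rewrite subnKC.
  by apply: eqf_sym; exact: lam_bracketE.
exact: (expressible_nablaD (smooth_bracketJ VS) (smooth_oppf PS) JV
  (expressible_nablaN PS PV)).
Qed.

Lemma expressible_bracketP a b c : (0 < a)%N -> (b <= m)%N -> (c <= m)%N ->
  (0 < b + c)%N -> (a + b + c = 2 * m)%N ->
  expressible (nablaf a (bracketf (@Pfun R) (quadratic b c))).
Proof.
move=> a0 bm cm bc abc; have DS := @smooth_DJ R; have PS := @smooth_Pf R.
have S1 := @smooth_cubic R 0 b _ _ _ PS (DS b) (DS c).
have S2 := @smooth_cubic R b c _ _ _ (DS b) (DS c) PS.
apply: (@expressible_nabla_eq _ m a (b + c)
  (addf (cubic 0 P b (D b) (D c)) (oppf (cubic b (D b) c (D c) P)))); first by lia.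
  move=> s I x sI Ux; rewrite /addf /oppf /bracketf /bracket /cubic /quadratic.
  congr (_ - _); first by rewrite /mulf /tensor_mul drop0.
  rewrite /mulf /tensor_mul (@take_oversize _ c) ?mulrA //.
  by rewrite size_drop sI addKn.
apply: (expressible_nablaD S1 (smooth_oppf S2)); first exact: expressible_P1.
exact: (expressible_nablaN S2 (expressible_P3 a0 bm cm bc abc)).
Qed.

(** [J, U V] = (J U + U J) V - U (J V + V J). *)
Lemma expressible_bracketJ a b c : (0 < a)%N -> (0 < b)%N -> (0 < c)%N ->
  (a + b + c = 2 * m)%N ->
  expressible (nablaf a (bracketf (@Jfun R) (quadratic b c))).
Proof.
move=> a0 b0 c0 abc; have DS := @smooth_DJ R.
have S1 := @smooth_mulf R b _ _ (smooth_anticomm b) (DS c).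
have S2 := @smooth_mulf R b _ _ (DS b) (smooth_anticomm c).
apply: (@expressible_nabla_eq _ m a (b + c)
  (addf (mulf b (anticomm b) (D c)) (oppf (mulf b (D b) (anticomm c))))); first by lia.
  move=> s I x sI Ux.
  have sI1 : size (take b I) = b by rewrite size_takel // sI leq_addr.
  have sI2 : size (drop b I) = c by rewrite size_drop sI addKn.
  rewrite -[I](cat_take_drop b); move: (take b I) (drop b I) sI1 sI2 => I1 I2 sI1 sI2.
  rewrite /addf /oppf /bracketf /bracket /quadratic !mulfE // !anticommE //.
  by rewrite mulrDl mulrDr !mulrA opprD addrA addrK.
apply: (expressible_nablaD S1 (smooth_oppf S2)).
  by apply: expressible_anticomm_mul.
by apply: (expressible_nablaN S2); apply: expressible_mul_anticomm => //; rewrite addnAC.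
Qed.

Lemma expressible_lam_quadratic_le a b c : (0 < a)%N ->
  (0 < b <= m)%N -> (0 < c <= m)%N -> (a + b + c = 2 * m)%N ->
  expressible (nablaf a (lam_bracket (quadratic b c))).
Proof.
move=> a0 /andP[b0 bm] /andP[c0 cm] abc.
apply: (expressible_lam_bracket _ (@smooth_quadratic b c)); first by lia.
  exact: expressible_bracketJ.
by apply: expressible_bracketP => //; lia.
Qed.

Lemma lam_bracketD V W :
  lam_bracket (addf V W) = addf (lam_bracket V) (lam_bracket W).
Proof.
apply: functional_extensionality_dep => c; apply/funext => I; apply/funext => x.
exact: bracketD.
Qed.

Lemma lam_bracketN V : lam_bracket (oppf V) = oppf (lam_bracket V).
Proof.
apply: functional_extensionality_dep => c; apply/funext => I; apply/funext => x.
exact: bracketN.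
Qed.

(** Integration by parts: with an outer derivative to spare, a derivative can be
    moved from one factor to the other. *)
Lemma expressible_lam_nabla1 a b c : (a + (b + c).+1 = 2 * m)%N ->
  expressible (nablaf a.+1 (lam_bracket (quadratic b c))) ->
  expressible (nablaf a (lam_bracket (quadratic b.+1 c))) <->
  expressible (nablaf a (lam_bracket (quadratic b c.+1))).
Proof.
move=> rk; rewrite nablafSr => g1; have QS := @smooth_quadratic.
have DS := @smooth_DJ R; have BS b' c' := smooth_lam_bracket (QS b' c').
have RS : smoothf (rearr (move_head b) (lam_bracket (quadratic b c.+1))).
  by apply: smooth_rearr; exact: BS.
have leib : eqf (b + c).+1 (nablaf 1 (lam_bracket (quadratic b c)))
    (addf (lam_bracket (quadratic b.+1 c))
       (rearr (move_head b) (lam_bracket (quadratic b c.+1)))).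
  apply: eqf_trans (nabla_lam_bracket _ (QS b c)) _.
  apply: eqf_trans (eqf_lam_bracket (@nabla1_mul _ b c _ _ (DS b) (DS c))) _.
  by rewrite lam_bracketD.
split=> [g2|/(proj2 (expressible_nabla_rearr m a _ (rearrangement_move_head b))) g3].
  apply/(expressible_nabla_rearr m a _ (rearrangement_move_head b)).
  exact: (expressible_addr rk (BS b.+1 c) RS leib g1 g2).
exact: (expressible_addl rk (BS b.+1 c) RS leib g1 g3).
Qed.

(** Move derivatives towards the factor of lower order until both orders are at
    most m; both cannot exceed m since their sum is less than 2m. *)
Lemma expressible_lam_quadratic a b c : (0 < a)%N -> (0 < b)%N -> (0 < c)%N ->
  (a + b + c = 2 * m)%N -> expressible (nablaf a (lam_bracket (quadratic b c))).
Proof.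
(* Truncated differences: the excess of the orders over m. *)
have [k ltk] := ubnP ((b - m) + (c - m))%N.
elim: k a b c ltk => // k IH a b c ltk a0 b0 c0 abc.
have [bm|bm] := leqP b m; have [cm|cm] := leqP c m.
- by apply: expressible_lam_quadratic_le => //; lia.
- case: c ltk c0 abc cm => [//|c] ltk _ abc cm.
  have rk : (a + (b + c).+1 = 2 * m)%N by lia.
  have g1 : expressible (nablaf a.+1 (lam_bracket (quadratic b c))) by apply: IH; lia.
  by apply: (proj1 (expressible_lam_nabla1 rk g1)); apply: IH; lia.
- case: b ltk b0 abc bm => [//|b] ltk _ abc bm.
  have rk : (a + (b + c).+1 = 2 * m)%N by lia.
  have g1 : expressible (nablaf a.+1 (lam_bracket (quadratic b c))) by apply: IH; lia.
  by apply: (proj2 (expressible_lam_nabla1 rk g1)); apply: IH; lia.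
- by exfalso; lia.
Qed.

Definition comm b : family := addf (mulf b (D b) J) (oppf (mulf 0 J (D b))).

Lemma smooth_comm b : smoothf (comm b).
Proof.
have JS := @smooth_Jf R; have DS := @smooth_DJ R b.
exact: (smooth_addf (@smooth_mulf _ b _ _ DS JS)
  (smooth_oppf (@smooth_mulf _ 0 _ _ JS DS))).
Qed.

Lemma commE b (c : setting R) I x : size I = b ->
  comm b I x = bracket (D b I x) (Jfun c x).
Proof.
by move=> sI; rewrite /comm /addf /oppf /mulf /tensor_mul drop0 (@take_oversize _ b) ?sI.
Qed.

Lemma nabla1_comm b : eqf b.+1 (nablaf 1 (comm b))
  (addf (comm b.+1) (addf (rearr (move_head b) (quadratic b 1)) (oppf (quadratic 1 b)))).
Proof.
have JS := @smooth_Jf R; have DS := @smooth_DJ R.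
have S1 := @smooth_mulf _ b _ _ (DS b) JS; have S2 := @smooth_mulf _ 0 _ _ JS (DS b).
apply: eqf_trans (@nablafD _ 1 _ _ _ S1 (smooth_oppf S2)) _.
move=> c I x sI Ux; rewrite {1}/addf (@nablafN _ 1 _ _ S2 c I x sI Ux) /oppf.
rewrite (@nabla1_mul _ 0 b _ _ JS (DS b) c I x sI Ux).
have sI0 : size I = (b + 0).+1 by rewrite addn0.
rewrite (@nabla1_mul _ b 0 _ _ (DS b) JS c I x sI0 Ux).
rewrite /comm /addf /oppf !nabla1_J !nabla1_D.
case: I sI sI0 => [//|i I] sI sI0.
rewrite [X in _ - (_ + X)]/rearr /move_head take0 drop0 cat0s.
by rewrite [X in _ - X]addrC opprD addrACA.
Qed.

Definition fourfold V := addf (addf V V) (addf V V).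

(** J anticommutes with its first derivative. *)
Lemma bracketJ_comm1 : eqf 1 (bracketf (@Jfun R) (comm 1)) (fourfold (D 1)).
Proof.
move=> c I x sI Ux; rewrite /bracketf commE // /bracket.
have JJ : Jfun c x * Jfun c x = -1 by rewrite -expr2 Jfun_sqr.
have /eqP := anticomm1 sI Ux; rewrite anticommE // addr_eq0 => /eqP JD.
have JDJ : Jfun c x * D 1 I x * Jfun c x = D 1 I x.
  by rewrite JD mulNr -mulrA JJ mulrN1 opprK.
rewrite mulrBr mulrBl !mulrA JDJ JJ mulN1r opprK -mulrA JJ mulrN1.
by rewrite -opprD opprK /fourfold /addf.
Qed.

Lemma nablaf_fourfold a k V : smoothf V ->
  eqf k (nablaf a (fourfold V)) (fourfold (nablaf a V)).
Proof.
move=> VS c I x sI Ux.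
by rewrite /fourfold (nablafD a (smooth_addf VS VS) (smooth_addf VS VS) sI Ux)
  {1 2}/addf (nablafD a VS VS sI Ux).
Qed.

(** The bracket with J gives the fourfold derivative, the bracket with P is
    expressible. *)
Lemma expressible_comm1 : (0 < m)%N ->
  expressible (addf (nablaf (2 * m).-1 (lam_bracket (comm 1)))
             (oppf (fourfold (D (2 * m))))).
Proof.
move=> m0; have CS := smooth_comm 1; have PS := smooth_bracketP CS.
have rk : ((2 * m).-1 + 1 = 2 * m)%N by lia.
have QS := @smooth_quadratic.
apply: (@expressible_eq _ m (oppf (nablaf (2 * m).-1 (bracketf (@Pfun R) (comm 1))))).
  rewrite -{1}rk => c I x sI Ux; apply/esym; rewrite /addf.
  rewrite (eqf_nabla (@lam_bracketE 1 (comm 1)) sI Ux).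
  rewrite (nablafD _ (smooth_bracketJ CS) (smooth_oppf PS) sI Ux) {1}/addf.
  rewrite (nablafN _ PS sI Ux) (eqf_nabla bracketJ_comm1 sI Ux).
  rewrite (nablaf_fourfold _ (@smooth_DJ R 1) sI Ux) -nablafSr.
  have -> : nablaf (2 * m).-1.+1 J = D (2 * m) by rewrite prednK //; lia.
  by rewrite addrAC /oppf subrr add0r.
apply: expressibleN.
(* J nabla J is a quadratic term with its blocks of indices exchanged, the first
   block being empty. *)
pose Q01 := rearr (swap_blocks 1) (quadratic 0 1).
have Q01S : smoothf Q01 by apply: smooth_rearr; exact: QS.
have SP1 := smooth_bracketP (QS 1%N 0%N); have SP2 := smooth_bracketP Q01S.
apply: (@expressible_nabla_eq _ m _ 1 (addf (bracketf (@Pfun R) (quadratic 1 0))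
    (oppf (bracketf (@Pfun R) Q01)))) => //.
  move=> c [//|i [|//]] x _ Ux; rewrite /addf /oppf /bracketf -bracketN -bracketD.
  by rewrite commE.
apply: (expressible_nablaD SP1 (smooth_oppf SP2)).
  by apply: expressible_bracketP; lia.
apply: (expressible_nablaN SP2).
apply: (proj2 (expressible_nabla_rearr m (2 * m).-1 (bracketf (@Pfun R) (quadratic 0 1))
  (rearrangement_swap_blocks 1))).
by apply: expressible_bracketP; lia.
Qed.

(** By [nabla1_comm], trading an outer derivative for an inner one only costs
    quadratic terms. *)
Lemma expressible_comm a b : (0 < m)%N -> (0 < a)%N -> (0 < b)%N -> (a + b = 2 * m)%N ->
  expressible (addf (nablaf a (lam_bracket (comm b))) (oppf (fourfold (D (2 * m))))).
Proof.
move=> m0; elim: b a => [//|[_|b IH]] a a0 _ ab.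
  have -> : a = (2 * m).-1 by lia.
  exact: expressible_comm1.
have QS := @smooth_quadratic; have CS := smooth_lam_bracket (smooth_comm b.+2).
have Q1 : smoothf (rearr (move_head b.+1) (quadratic b.+1 1)).
  by apply: smooth_rearr; exact: QS.
pose W := lam_bracket
  (addf (rearr (move_head b.+1) (quadratic b.+1 1)) (oppf (quadratic 1 b.+1))).
have WS : smoothf W := smooth_lam_bracket (smooth_addf Q1 (smooth_oppf (QS 1%N b.+1))).
have WE : W = addf (rearr (move_head b.+1) (lam_bracket (quadratic b.+1 1)))
    (oppf (lam_bracket (quadratic 1 b.+1))) by rewrite /W lam_bracketD lam_bracketN.
have Wg : expressible (nablaf a W).
  rewrite WE; apply: expressible_nablaD.
  - by apply: smooth_rearr; exact: smooth_lam_bracket (QS _ _).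
  - by apply: smooth_oppf; exact: smooth_lam_bracket (QS _ _).
  - apply/(expressible_nabla_rearr m a _ (rearrangement_move_head b.+1)).
    by apply: expressible_lam_quadratic; lia.
  - apply: (expressible_nablaN (smooth_lam_bracket (QS _ _))).
    by apply: expressible_lam_quadratic; lia.
have rk : (a.+1 + b.+1 = 2 * m)%N by lia.
have IHa := IH a.+1 isT isT rk.
apply: expressible_eq (expressibleD IHa (expressibleN Wg)).
rewrite -rk addSnnS => c I x sI Ux.
rewrite /addf /oppf addrAC; congr (_ - _); apply/eqP; rewrite subr_eq; apply/eqP.
rewrite nablafSr.
have E : eqf b.+2 (nablaf 1 (lam_bracket (comm b.+1))) (addf (lam_bracket (comm b.+2)) W).
  apply: eqf_trans (nabla_lam_bracket _ (smooth_comm b.+1)) _.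
  apply: eqf_trans (eqf_lam_bracket (@nabla1_comm b.+1)) _.
  by rewrite lam_bracketD.
by rewrite (eqf_nabla E sI Ux) (nablafD a CS WS sI Ux).
Qed.

End Brackets.

(** * Folding the derivatives and conclusion *)

Section Reversal.
Context {R : realType}.
Local Notation family := (@family R).
Implicit Types (V W X : family).
Variable m : nat.
Local Notation expressible := (@expressible R m).
Hypothesis m_le3 : (m <= 3)%N.
Hypothesis m_gt0 : (0 < m)%N.
Local Notation D := (@DJ R).

(** The weaker condition on the one contraction that produces Delta^m; it is not
    invariant under rearrangements. *)
Definition laplacian_spanned V := spanned m (contractf (standard_pairing m) V).

Lemma expressible_laplacian V : expressible V -> laplacian_spanned V.
Proof. by move=> Vg; apply: Vg; [rewrite mul2n|exact: is_pairing_standard]. Qed.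

Lemma laplacian_spannedB V W : laplacian_spanned V -> laplacian_spanned W ->
  laplacian_spanned (addf V (oppf W)).
Proof.
move=> Vs Ws; apply: eq_spanned (spannedD Vs (spannedN Ws)) => c.
by rewrite /contractf contractD contractN.
Qed.

Lemma eq_laplacian_spanned V W : eqf (2 * m) V W ->
  laplacian_spanned V -> laplacian_spanned W.
Proof.
move=> VW; apply: eq_spanned => c.
by apply: (eq_contract _ _ _ (pointP c)); rewrite -mul2n.
Qed.

Definition revtake b S (I : seq S) := rev (take b I) ++ drop b I.

Lemma rearrangement_revtake b : rearrangement (revtake b).
Proof.
split=> [S S' f I|S I].
  by rewrite /revtake map_cat map_rev map_take map_drop.
by rewrite -[X in perm_eq _ X](cat_take_drop b) perm_cat2r perm_rev.
Qed.

(** The commutator of nabla^(2m - c) J with nabla^c J, whose indices are the first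
    c ones in reverse order. Reversal records that derivatives have been moved one
    by one, the outermost first. *)
Definition folded c : family :=
  addf (rearr (rotrev c) (quadratic (2 * m - c) c))
       (oppf (rearr (revtake c) (quadratic c (2 * m - c)))).

Lemma foldedE b (c : setting R) I1 I2 x : size I1 = b -> (b + size I2 = 2 * m)%N ->
  folded b (c := c) (I1 ++ I2) x =
  D (2 * m - b) I2 x * D b (rev I1) x - D b (rev I1) x * D (2 * m - b) I2 x.
Proof.
move=> sI1 sI2; rewrite /folded /addf /oppf /rearr /rotrev /revtake.
rewrite take_size_cat // drop_size_cat // /quadratic !mulfE ?size_rev //.
by rewrite -sI2 addKn.
Qed.

(** Two successive foldings are the two halves of a Leibniz rule. *)
Lemma folded_step c : (c < m)%N -> eqf (2 * m) (addf (folded c) (folded c.+1))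
  (addf (rearr (rotrev c) (nablaf 1 (quadratic (2 * m - c.+1) c)))
    (oppf (rearr (revtake c.+1) (nablaf 1 (quadratic c (2 * m - c.+1)))))).
Proof.
move=> cm s I x sI Ux; have DS := @smooth_DJ R.
have sI1 : size (take c I) = c by rewrite size_takel // sI; lia.
have sI2 : size (drop c I) = (2 * m - c)%N by rewrite size_drop sI.
rewrite -[I](cat_take_drop c).
move: (take c I) (drop c I) sI1 sI2 => I1 [|i I2] sI1 /= sI2; first by exfalso; lia.
have sI2' : size I2 = (2 * m - c.+1)%N by lia.
have sI1' : size (rev (rcons I1 i)) = c.+1 by rewrite size_rev size_rcons sI1.
rewrite {1}/addf foldedE //=; last by lia.
rewrite -cat_rcons foldedE ?size_rcons ?sI1 //; last by lia.
rewrite /addf /oppf /rearr /rotrev /revtake.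
rewrite (take_size_cat _ (_ : size (rcons I1 i) = c.+1)) ?size_rcons ?sI1 //.
rewrite (drop_size_cat _ (_ : size (rcons I1 i) = c.+1)) ?size_rcons ?sI1 //.
rewrite cat_rcons take_size_cat // drop_size_cat //.
have sL : size ((i :: I2) ++ rev I1) = (2 * m - c.+1 + c).+1.
  by rewrite size_cat /= size_rev; lia.
have sR : size (rev (rcons I1 i) ++ I2) = (c + (2 * m - c.+1)).+1.
  by rewrite size_cat sI1'; lia.
rewrite (nabla1_mul (DS (2 * m - c.+1)%N) (DS c) sL Ux).
rewrite (nabla1_mul (DS c) (DS (2 * m - c.+1)%N) sR Ux).
rewrite /addf /rearr rev_rcons cat_cons !move_headE ?size_rev //.
rewrite !nabla1_D -!cat_cons !mulfE ?size_rev ?sI1 //; last 2 first.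
- by rewrite /= size_rev sI1.
- by rewrite /= sI2'.
rewrite -[catrev I1 [::]]/(rev I1) subnSK; last by lia.
by rewrite addrACA -opprD [X in _ - X = _]addrC.
Qed.

(** Reversing all indices exchanges the two factors of the commutator, hence
    changes its sign, and preserves the contraction. *)
Lemma folded_mid : contractf (standard_pairing m) (lam_bracket (folded m))
  = fun c => 0.
Proof.
apply: functional_extensionality_dep => c; rewrite /contractf contract_bracket.
have Ux := pointP c; set X := Defs.contract _ _ _ _.
suff : X = - X.
  move/eqP; rewrite -subr_eq0 opprK -mulr2n -scaler_nat scaler_eq0 pnatr_eq0 /=.
  by move=> /eqP ->; rewrite /bracket mulr0 mul0r subrr.
rewrite {1}/X -(contract_standard_rev (metricP c)) // -contractN.
apply: (@eq_contract _ _ _ unit_ball) => // I x sI Ux'.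
have sI1 : size (take m I) = m by rewrite size_takel // sI; lia.
have sI2 : size (drop m I) = m by rewrite size_drop sI; lia.
rewrite -[I](cat_take_drop m); move: (take m I) (drop m I) sI1 sI2 => I1 I2 sI1 sI2.
have mm : (2 * m - m = m)%N by lia.
rewrite rev_cat !foldedE ?size_rev ?sI1 ?sI2 ?mm //; try lia.
by rewrite revK opprB.
Qed.

Lemma expressible_lam_nabla_quadratic b c : (0 < b)%N -> (0 < c)%N ->
  (b + c + 1 = 2 * m)%N -> expressible (lam_bracket (nablaf 1 (quadratic b c))).
Proof.
move=> b0 c0 bc.
apply: (expressible_eq (nabla_lam_bracket _ (@smooth_quadratic R b c))).
by apply: expressible_lam_quadratic => //; lia.
Qed.

(** Consecutive foldings differ by a sign, modulo expressible tensors; start from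
    the middle one. *)
Lemma folded_spanned k b : (b + k = m)%N -> (0 < b)%N ->
  laplacian_spanned (lam_bracket (folded b)).
Proof.
elim: k b => [|k IH] b bk b0.
  have -> : b = m by lia.
  by rewrite /laplacian_spanned folded_mid; exact: spanned0.
have bm : (b < m)%N by lia.
have IHb : laplacian_spanned (lam_bracket (folded b.+1)) by apply: IH; lia.
have g1 : expressible
    (rearr (rotrev b) (lam_bracket (nablaf 1 (quadratic (2 * m - b.+1) b)))).
  apply: (proj2 (expressible_rearr m _ (rearrangement_rotrev b))).
  by apply: expressible_lam_nabla_quadratic; lia.
have g2 : expressible
    (rearr (revtake b.+1) (lam_bracket (nablaf 1 (quadratic b (2 * m - b.+1))))).
  apply: (proj2 (expressible_rearr m _ (rearrangement_revtake b.+1))).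
  by apply: expressible_lam_nabla_quadratic; lia.
have gS := expressibleD g1 (expressibleN g2).
apply: eq_laplacian_spanned (laplacian_spannedB (expressible_laplacian gS) IHb).
move=> c I x sI Ux; have := eqf_lam_bracket (folded_step bm) sI Ux.
rewrite (lam_bracketD (folded b)) (lam_bracketD (rearr _ _)) lam_bracketN => E.
transitivity (addf (lam_bracket (folded b)) (lam_bracket (folded b.+1)) I x
              - lam_bracket (folded b.+1) I x).
  exact: (congr1 (fun M => M - lam_bracket (folded b.+1) I x) (esym E)).
by rewrite {1}/addf addrK.
Qed.

(** The remainder of the Leibniz rule for [nabla^(2m-1) J, J] is the first
    folding. *)
Lemma comm_spanned : laplacian_spanned
  (addf (lam_bracket (comm (2 * m))) (oppf (fourfold (D (2 * m))))).
Proof.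
have f1 : laplacian_spanned (lam_bracket (folded 1)).
  by apply: (@folded_spanned m.-1); lia.
have g1 : expressible (addf (nablaf 1 (lam_bracket (comm (2 * m).-1)))
                            (oppf (fourfold (D (2 * m))))).
  by apply: expressible_comm => //; lia.
apply: eq_laplacian_spanned (laplacian_spannedB (expressible_laplacian g1) f1).
have m2 : ((2 * m).-1.+1 = 2 * m)%N by lia.
rewrite -{1}m2 => c I x sI Ux.
rewrite /addf /oppf addrAC; congr (_ - _); apply/eqP; rewrite subr_eq; apply/eqP.
rewrite (nabla_lam_bracket _ (@smooth_comm R (2 * m).-1) sI Ux).
rewrite (eqf_lam_bracket (@nabla1_comm R (2 * m).-1) sI Ux) m2 lam_bracketD {1}/addf.
congr (_ + _); apply: (eqf_lam_bracket _ sI Ux).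
move=> {c I x sI Ux} c [//|i I] x [sI] Ux.
rewrite -[i :: I in RHS]cat1s foldedE //; last by rewrite sI; lia.
rewrite /addf /oppf /rearr -{1}(cats0 I) move_headE //.
by rewrite /quadratic -(cat1s i I) !mulfE // subn1.
Qed.

End Reversal.

Lemma contract_bracketr (R : realType) n N (g : 'rV[R]_n -> 'M[R]_n) k
    (sigma : 'S_k) (T : @tensor R n 'M[R]_N) (F : 'rV[R]_n -> 'M[R]_N) x :
  Defs.contract g sigma (fun I y => bracket (T I y) (F y)) x
  = bracket (Defs.contract g sigma T x) (F x).
Proof.
have bracketC (A B : 'M[R]_N) : bracket A B = - bracket B A.
  by rewrite /bracket opprB.
rewrite bracketC -contract_bracket -contractN.
by apply: eq_bigr => t _; rewrite bracketC.
Qed.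

Lemma laplace_pow_contract (R : realType) n N (U : set 'rV[R]_n)
    (g : 'rV[R]_n -> 'M[R]_n) m (F : 'rV[R]_n -> 'M[R]_N) x :
  open U -> metric_on U g -> smooth_mx_on U F -> U x ->
  laplace_pow g m F x = Defs.contract g (standard_pairing m) (nabla_fun g (2 * m) F) x.
Proof.
move=> openU metric_g FS Ux.
by rewrite contract_standard mul2n (laplace_powE openU metric_g).
Qed.

Lemma laplacian_bracket_spanned (R : realType) m : (1 <= m <= 3)%N ->
  spanned m (fun c : setting R =>
    let L := laplace_pow (metric c) m (Jfun c) (point c) in
    (L + L) + (L + L) - bracket (lambda c) (bracket L (Jfun c (point c)))).
Proof.
move=> /andP[m0 m3]; apply: eq_spanned (spannedN (comm_spanned m3 m0)) => c.
have Ux := pointP c.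
rewrite (laplace_pow_contract m open_unit_ball (metricP c) (smooth_Jfun c) Ux) /=.
rewrite /contractf contractD contractN opprB contract_bracket -contract_bracketr.
congr (_ - bracket _ _); first by rewrite !contractD.
apply: (@eq_contract _ _ _ unit_ball) => // I x sI Ux'.
by rewrite commE // mul2n.
Qed.

Lemma laplace_pow_cst (R : realType) (m n N : nat) (g : 'rV[R]_n -> 'M[R]_n)
    (F : 'rV[R]_n -> 'M[R]_N) (C : 'M[R]_N) x : (0 < m)%N ->
  metric_on unit_ball g -> smooth_mx_on unit_ball F ->
  (forall y, unit_ball y -> F y = C) -> unit_ball x -> laplace_pow g m F x = 0.
Proof.
move=> m0 metric_g FS FC Ux.
rewrite (laplace_pow_contract m open_unit_ball metric_g FS Ux).
have dF : eq_tensor unit_ball 1 (nabla_fun g 1 F) (fun _ _ => 0).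
  move=> [//|i [|//]] y _ Uy; rewrite /nabla_fun nablaS cov_mx_cons big_nil subr0.
  rewrite (eq_partial_mx open_unit_ball _ Uy (H := fun=> C)) => [|z Uz].
    exact: partial_mx_cst.
  exact: FC.
have m2 : (2 * m = (2 * m).-1 + 1)%N by lia.
have dF2 : eq_tensor unit_ball (2 * m) (nabla_fun g (2 * m) F) (fun _ _ => 0).
  have -> : nabla_fun g (2 * m) F = nabla g (2 * m).-1 (nabla_fun g 1 F).
    by rewrite /nabla_fun /nabla -iterSr prednK //; lia.
  rewrite [X in eq_tensor _ X]m2.
  apply: (eq_tensor_trans (@eq_nabla _ _ _ _ g open_unit_ball _ _ _ _ dF)).
  exact: (@nabla0 _ _ _ _ g open_unit_ball).
rewrite (@eq_contract _ _ _ unit_ball g _ _ _ (fun _ _ => 0)) //.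
  by rewrite /Defs.contract big1 // => t _; rewrite scaler0.
by rewrite -mul2n.
Qed.

Lemma T_on_ball (R : realType) (m n N : nat) (g : 'rV[R]_n -> 'M[R]_n)
    (J : 'rV[R]_n -> 'M[R]_N) x : (0 < m)%N ->
  metric_on unit_ball g -> smooth_mx_on unit_ball J ->
  (forall x, unit_ball x -> J x ^+ 2 = - 1) ->
  unit_ball x -> let L := laplace_pow g m J x in
  T_ g m J x = (L + L) - (J x * L * J x + J x * L * J x).
Proof.
move=> m0 metric_g JS JJ Ux L.
have J2S : smooth_mx_on unit_ball (fun y => J y ^+ 2).
  exact: (smooth_mxM open_unit_ball JS JS).
rewrite /T_ /Q_ (laplace_pow_cst m0 metric_g J2S JJ Ux) -/L sub0r.
have JJx : J x * J x = -1 by rewrite -expr2 JJ.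
rewrite mulrBr mulrBl mulrN mulNr !mulrA JJx -[L * J x * J x]mulrA JJx.
rewrite mulrN1 mulN1r !opprK addrACA [X in _ + X]addrC.
by rewrite [- _ + L]addrC addrACA -opprD.
Qed.

Theorem proposition8p2 (R : realType) (m : nat) (hm : (1 <= m <= 3)%N) :
  exists (k : nat) (coef : 'I_k -> R) (t : 'I_k -> term),
    (forall i, admissible m (t i)) /\
    forall (n N : nat) (g : 'rV[R]_n -> 'M[R]_n) (J : 'rV[R]_n -> 'M[R]_N)
      (lambda0 : 'M[R]_N),
      metric_on unit_ball g ->
      smooth_mx_on unit_ball J ->
      (forall x, unit_ball x -> J x ^+ 2 = - 1) ->
      forall x, unit_ball x ->
        T_ g m J x =
          \sum_(i < k) coef i *: eval_term g J lambda0 (t i) x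
          - bracket (J x - lambda0) (bracket (laplace_pow g m J x) (J x)).
Proof.
have [k [coef [t [adm spanE]]]] := laplacian_bracket_spanned R hm.
exists k, coef, t; split=> // n N g J lambda0 metric_g JS JJ x Ux.
have := spanE (Setting lambda0 metric_g JS JJ Ux); rewrite /= => <-.
set L := laplace_pow g m J x.
have [m0 _] := andP hm; rewrite (T_on_ball m0 metric_g JS JJ Ux) -/L.
have JJx : J x * J x = -1 by rewrite -expr2 JJ.
have -> : bracket (J x - lambda0) (bracket L (J x)) =
    bracket (J x) (bracket L (J x)) - bracket lambda0 (bracket L (J x)).
  move: (bracket L (J x)) => X; rewrite /bracket mulrBl mulrBr !opprB.
  by rewrite addrACA [RHS]addrACA; congr (_ + _); rewrite addrC.
move: (bracket lambda0 _) => Z; rewrite opprB [RHS]addrA subrK.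
rewrite /bracket mulrBr mulrBl !mulrA JJx -[L * J x * J x]mulrA JJx.
rewrite mulN1r mulrN1 opprK.
move: (J x * L * J x) => A.
rewrite -[- L - A]opprD opprK [A + L]addrC [L + A + _]addrACA.
by rewrite [- (L + L + _)]opprD [RHS]addrA addrK.
Qed.
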